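(* Let $1<\bar p<\infty$ and $0<\bar q\le\infty$, where $\bar p=(p_1,p_2)$, $\bar q=(q_1,q_2)$ and the inequalities are meant coordinatewise, let $\bar\sigma=\frac12-\frac1{\bar p}$, i.e. $\bar\sigma=(\sigma_1,\sigma_2)$ with $\sigma_i=\frac12-\frac1{p_i}$, and let $M$ be the set of all rectangles in $[0,1]^2$. Let $f\in L_1[0,1]^2$. Then, for $f\in N_{\bar p,\bar q}(M)$ it is necessary and sufficient that the sequence of its Fourier-Haar coefficients $a=\{a_{k_1k_2}^{j_1j_2}:k_i\in\mathbb Z_+,\ 1\le j_i\le 2^{k_i},\ i=1,2\}$ belong to the space $l_{\bar q}^{\bar\sigma}(l_\infty)$, and the relation $$\|f\|_{N_{\bar p,\bar q}(M)}\asymp\|a\|_{l_{\bar q}^{\bar\sigma}(l_\infty)}$$ holds.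
   Context: The relation $A\asymp B$ means $c_1B\le A\le c_2B$ with constants $c_1,c_2>0$ not depending on $f$. Haar system. The Haar system on $[0,1]$ is $\{\chi_n\}_{n=1}^\infty$, where $\chi_1\equiv1$ and, for $n=2^k+j$ with $k=0,1,\dots$ and $j=1,\dots,2^k$, $$\chi_n(x)=\chi_k^j(x)=\begin{cases}2^{k/2}, & \frac{2j-2}{2^{k+1}}<x<\frac{2j-1}{2^{k+1}},\\ -2^{k/2}, & \frac{2j-1}{2^{k+1}}<x<\frac{2j}{2^{k+1}},\\ 0, & x\notin\left(\frac{j-1}{2^k},\frac{j}{2^k}\right).\end{cases}$$ Fourier-Haar coefficients. For $f\in L_1[0,1]^2$ the Fourier-Haar series is $$f(x_1,x_2)\sim\sum_{k_1=0}^\infty\sum_{k_2=0}^\infty\sum_{j_1=1}^{2^{k_1}}\sum_{j_2=1}^{2^{k_2}}a_{k_1k_2}^{j_1j_2}\chi_{k_1}^{j_1}(x_1)\chi_{k_2}^{j_2}(x_2),$$ with coefficients, for $k_i\in\mathbb Z_+=\{0,1,2,\dots\}$ and $1\le j_i\le2^{k_i}$, $$a_{k_1k_2}^{j_1j_2}=\int_0^1\int_0^1 f(x_1,x_2)\chi_{k_1}^{j_1}(x_1)\chi_{k_2}^{j_2}(x_2)\,dx_1dx_2.$$ Sequence space. For $\bar\sigma=(\sigma_1,\sigma_2)\in\mathbb R^2$ and $0<\bar q\le\infty$, $l_{\bar q}^{\bar\sigma}(l_\infty)$ is the set of all sequences $a=\{a_{k_1k_2}^{j_1j_2}:k_i\in\mathbb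 Z_+,\ 1\le j_i\le2^{k_i},\ i=1,2\}$ for which $$\|a\|_{l_{\bar q}^{\bar\sigma}(l_\infty)}=\left(\sum_{k_2=0}^\infty\left(\sum_{k_1=0}^\infty\left(2^{\sigma_1k_1+\sigma_2k_2}\sup_{1\le j_i\le2^{k_i},\ i=1,2}|a_{k_1k_2}^{j_1j_2}|\right)^{q_1}\right)^{q_2/q_1}\right)^{1/q_2}$$ is finite, where $\left(\sum_{k=0}^\infty b_k^q\right)^{1/q}$ is understood as $\sup_{k\ge0}b_k$ when $q=\infty$. Net space. For $f$ integrable on each rectangle $Q=Q_1\times Q_2\in M$ ($Q_i$ segments, $|Q_i|$ the length of $Q_i$) and $t_1,t_2>0$ put $$\bar f(t_1,t_2;M)=\sup_{Q_1\times Q_2\in M,\ |Q_i|\ge t_i}\frac1{|Q_1||Q_2|}\left|\int_{Q_1}\int_{Q_2}f(x_1,x_2)\,dx_1dx_2\right|$$ (with $x_i$ ranging over $Q_i$; the supremum over the empty set is $0$). For $0<\bar p<\infty$, $0<\bar q\le\infty$, $N_{\bar p,\bar q}(M)$ is the set of all functions $f$ for which $$\|f\|_{N_{\bar p,\bar q}(M)}=\left(\int_0^\infty\left(\int_0^\infty\left(t_1^{1/p_1}t_2^{1/p_2}\bar f(t_1,t_2;M)\right)^{q_1}\frac{dt_1}{t_1}\right)^{q_2/q_1}\frac{dt_2}{t_2}\right)^{1/q_2}<\infty,$$ where $\left(\int_0^\infty\varphi(t)^q\frac{dt}{t}\right)^{1/q}$ is understood as $\sup_{t>0}\varphi(t)$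 when $q=\infty$.
   Formalization: As stated the claim fails for f≡1 (all listed coefficients are 0). Proved instead: for all f in L_1, with the coefficients involving χ_1 added at level k=0; and with the listed coefficients only, for f whose coefficients involving χ_1 vanish. *)

(* Defs.v *)
From mathcomp Require Import all_boot all_order all_algebra.
From mathcomp Require Import all_classical all_reals all_analysis.

Set Implicit Arguments.
Unset Strict Implicit.
Unset Printing Implicit Defensive.

Import Order.TTheory GRing.Theory Num.Theory.
Import numFieldNormedType.Exports.

Local Open Scope classical_set_scope.
Local Open Scope ring_scope.

Notation lebesgue2 R := (@lebesgue_measure R \x @lebesgue_measure R)%E.

Section HaarNet.
Variable R : realType.

Definition L1_unit_square (f : R * R -> R) : Prop :=
  (lebesgue2 R).-integrable (`[0, 1] `*` `[0, 1]) (EFin \o f).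

(* The Haar functions chi_n are indexed by n = 2 ^ k + j. The pair
   (k, j) = (0, 0) corresponds to n = 1, that is, to the constant function 1;
   pairs (k, 0) with k > 0 are never used. At the midpoint of its support,
   haar k j takes the value 0. *)
Definition haar (k j : nat) (x : R) : R :=
  if j == 0%N then 1
  else if ((2 * j)%:R - 2) / 2 ^+ k.+1 < x < ((2 * j)%:R - 1) / 2 ^+ k.+1
  then 2 `^ (k%:R / 2)
  else if ((2 * j)%:R - 1) / 2 ^+ k.+1 < x < (2 * j)%:R / 2 ^+ k.+1
  then - 2 `^ (k%:R / 2)
  else 0.

Definition haar_coef (f : R * R -> R) (k1 k2 j1 j2 : nat) : R :=
  \int[lebesgue2 R]_(x in `[0, 1] `*` `[0, 1])
     (f x * haar k1 j1 x.1 * haar k2 j2 x.2).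

(* The indices j = 1, ..., 2 ^ k of the nonconstant Haar functions of level k. *)
Definition haar_level (k : nat) : set nat := [set j | (1 <= j <= 2 ^ k)%N].

(* Same, with the constant Haar function put in level 0; the union of these
   levels over all k is the whole Haar system. *)
Definition haar_level_full (k : nat) : set nat :=
  [set j | haar_level k j \/ (k = 0%N /\ j = 0%N)].

(* All the Fourier-Haar coefficients of f in which the constant function
   occurs in at least one of the two variables vanish, i.e. the Fourier-Haar
   series of f only contains the products of nonconstant Haar functions. *)
Definition no_constant_terms (f : R * R -> R) : Prop :=
  forall k j, haar_level_full k j ->
    haar_coef f 0 k 0 j = 0 /\ haar_coef f k 0 j 0 = 0.

(* (sum_k b_k ^ q) ^ (1 / q) for nonnegative b, a supremum when q = +oo. *)
Definition lq_norm (q : \bar R) (b : nat -> \bar R) : \bar R :=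
  match q with
  | r%:E => (\sum_(0 <= k <oo) b k `^ r) `^ r^-1
  | +oo => ereal_sup (range b)
  | -oo => 0
  end%E.

(* (int_0^oo phi(t) ^ q dt / t) ^ (1 / q) for nonnegative phi, a supremum
   (not an essential one) when q = +oo. *)
Definition Lq_dt_over_t_norm (q : \bar R) (phi : R -> \bar R) : \bar R :=
  match q with
  | r%:E => (\int[@lebesgue_measure R]_(t in `]0%R, +oo[)
               (phi t `^ r * (t^-1)%:E)) `^ r^-1
  | +oo => ereal_sup [set phi t | t in `]0%R, +oo[]
  | -oo => 0
  end%E.

(* The norm of the space l_q^sigma(l_oo); level k is the range of j_i for
   k_i = k, which is haar_level k in the usual definition. *)
Definition seq_norm (level : nat -> set nat) (s1 s2 : R) (q1 q2 : \bar R)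
    (a : nat -> nat -> nat -> nat -> R) : \bar R :=
  lq_norm q2 (fun k2 => lq_norm q1 (fun k1 =>
    ((2 `^ (s1 * k1%:R + s2 * k2%:R))%R%:E *
     ereal_sup [set `|a k1 k2 j.1 j.2|%:E | j in level k1 `*` level k2])%E)).

Definition seq_space (level : nat -> set nat) (s1 s2 : R) (q1 q2 : \bar R) :
    set (nat -> nat -> nat -> nat -> R) :=
  [set a | (seq_norm level s1 s2 q1 q2 a < +oo)%E].

Definition is_segment (I : set R) : Prop :=
  exists a b : R, a < b /\ I = `[a, b]%classic.

(* The pair (Q1, Q2) stands for the rectangle Q1 x Q2. *)
Definition unit_square_rectangles : set (set R * set R) :=
  [set Q | [/\ is_segment Q.1, is_segment Q.2,
               Q.1 `<=` `[0, 1] & Q.2 `<=` `[0, 1]]].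

Definition len (I : set R) : R := fine (@lebesgue_measure R I).

(* 0 is added to the set so that the supremum over no rectangle is 0. *)
Definition net_average (M : set (set R * set R)) (f : R * R -> R)
    (t1 t2 : R) : \bar R :=
  ereal_sup ([set 0%E] `|`
    [set ((len Q.1 * len Q.2)^-1 *
          `| \int[lebesgue2 R]_(x in Q.1 `*` Q.2) f x |)%:E
      | Q in [set Q | [/\ M Q, t1 <= len Q.1 & t2 <= len Q.2]]]).

Definition net_norm (p1 p2 : R) (q1 q2 : \bar R) (M : set (set R * set R))
    (f : R * R -> R) : \bar R :=
  Lq_dt_over_t_norm q2 (fun t2 => Lq_dt_over_t_norm q1 (fun t1 =>
    ((t1 `^ p1^-1 * t2 `^ p2^-1)%R%:E * net_average M f t1 t2)%E)).

Definition net_space (p1 p2 : R) (q1 q2 : \bar R) (M : set (set R * set R)) :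
    set (R * R -> R) :=
  [set f | (forall Q, M Q ->
              (lebesgue2 R).-integrable (Q.1 `*` Q.2) (EFin \o f)) /\
           (net_norm p1 p2 q1 q2 M f < +oo)%E].

End HaarNet.

Arguments unit_square_rectangles {R}.

(* Main.v *)
Require Import Defs.
From mathcomp Require Import all_boot all_order all_algebra.
From mathcomp Require Import all_classical all_reals all_analysis.
From mathcomp Require Import measurable_realfun.
From mathcomp Require Import lra zify.

Import Order.TTheory GRing.Theory Num.Theory.
Import numFieldNormedType.Exports.

Local Open Scope classical_set_scope.
Local Open Scope ring_scope.

Set Implicit Arguments.
Unset Strict Implicit.
Unset Printing Implicit Defensive.

(* Since the averages are monotone in t, the net norm is comparable to the mixed
   l_q norm of b(n) = 2^(-n1/p1 - n2/p2) F(2^-n1, 2^-n2), where F is the net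
   average. A Haar coefficient of level k is a signed sum of integrals of f over
   four dyadic rectangles of sides 2^(-k1-1), 2^(-k2-1), so it is bounded by
   F(2^(-k1-1), 2^(-k2-1)). Conversely the Haar expansion of the indicator of an
   interval Q has l_1-norm at most 3 |Q| 2^(k/2) min(1, 2^(n-k)) on level k when
   |Q| >= 2^-n. Its partial sums are bounded and converge off a null set, so by
   dominated convergence the integral of f over a rectangle is controlled by the
   coefficients, and b(n) is at most a constant times
   sup_k eta^(3|k1-n1| + 3|k2-n2|) alpha(k), where alpha(k) is the k-th term of
   the sequence norm and eta < 1 because p > 1. Such a weighted supremum is
   bounded on l_q for every q > 0. *)

(** * Sequence norms *)

(** The exponent 3 counts the uses of the weight in the second variable. One power of [eta] sums the
    series over the levels, which is thereby traded for a supremum. A second one moves the supremum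
    over k2 out of the inner l_q1 norm, where no triangle inequality is available for q1 < 1. The
    third is spent in the outer l_q2 norm. The first variable needs only two of its three powers.
    Expanding the indicator rather than [f] makes the partial sums explicit: they are averages over
    dyadic intervals, so [|f|] dominates the integrands. Measurability of the integrands in the net
    norm is never discussed. Both bounds compare them with step functions on dyadic shells, and for
    nonnegative functions the integral, a supremum over simple functions, is monotone in any
    case. *)

Lemma poweR_mono {R : realType} (r : R) (x y : \bar R) :
  0 <= r -> (0 <= x)%E -> (x <= y)%E -> (x `^ r <= y `^ r)%E.
Proof.
move=> r0 x0 xy; apply: gt0_ler_poweR => //; rewrite in_itv/= leey andbT//.
exact: le_trans xy.
Qed.

Lemma poweRK {R : realType} (r : R) (x : \bar R) :
  0 < r -> (0 <= x)%E -> ((x `^ r) `^ r^-1 = x)%E.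
Proof. by move=> r0 x0; rewrite -poweRrM divff ?gt_eqF// poweRe1. Qed.

Lemma poweRVK {R : realType} (r : R) (x : \bar R) :
  0 < r -> (0 <= x)%E -> ((x `^ r^-1) `^ r = x)%E.
Proof. by move=> r0 x0; rewrite -poweRrM mulVf ?gt_eqF// poweRe1. Qed.

Lemma poweR_series_ge_sup {R : realType} (r : R) (x : nat -> \bar R) :
  0 < r -> (forall k, 0 <= x k)%E ->
  ((ereal_sup (range x)) `^ r <= \sum_(0 <= k <oo) x k `^ r)%E.
Proof.
move=> r0 x0; set S := limn _.
have S0 : (0 <= S)%E by apply: nneseries_ge0 => n _ _; exact: poweR_ge0.
rewrite -[leRHS](poweRVK r0)//; apply: poweR_mono; first exact: ltW.
  by apply: le_ereal_sup_tmp; exists (x 0) => //; exists 0.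
apply/ereal_supP => _ [k _ <-]; rewrite -[leLHS](poweRK r0)//.
apply: poweR_mono; [by rewrite invr_ge0 ltW|exact: poweR_ge0|].
apply: le_trans (nneseries_lim_ge k.+1 _) => /=.
  rewrite big_nat_recr//= leeDr// sume_ge0// => i _; exact: poweR_ge0.
by move=> n _ _; exact: poweR_ge0.
Qed.

Lemma powR_exprn {R : realType} (a r : R) n :
  0 <= a -> (a ^+ n) `^ r = (a `^ r) ^+ n.
Proof.
move=> a0; rewrite -(powR_mulrn n a0) -(powR_mulrn n (powR_ge0 a r)).
by rewrite -!powRrM mulrC.
Qed.

(** Truncated subtraction makes one summand vanish, so this is |m - n|. *)
Definition dist (m n : nat) : nat := (m - n + (n - m))%N.

Lemma dist_sym m n : dist m n = dist n m.
Proof. by rewrite /dist addnC. Qed.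

Lemma sum_expr_dist {R : realType} (rho : R) (n N : nat) : 0 < rho < 1 ->
  \sum_(0 <= m < N) rho ^+ dist m n <= 2 / (1 - rho).
Proof.
move=> /andP[r0 r1]; rewrite ler_pdivlMr ?subr_gt0// mulrC.
(* Multiplying by [1 - rho] makes the sum telescope. The claim is an inductive form of that bound:
   at most 1 while [N <= n], then approaching 2. *)
suff H : (1 - rho) * \sum_(0 <= m < N) rho ^+ dist m n <=
    if (N <= n)%N then rho ^+ (n - N) else 2 - rho ^+ (N - n).
  apply: le_trans H _; case: ifP => _.
    by apply: (@le_trans _ _ 1); rewrite ?exprn_ile1 ?ltW// ltr_pwDl.
  by rewrite gerBl exprn_ge0 ?ltW.
elim: N => [|N IH]; first by rewrite big_geq// mulr0 exprn_ge0// ltW.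
rewrite big_nat_recr//= mulrDr; apply: le_trans (lerD IH (lexx _)) _.
have [lt|gt|->] := ltngtP N n.
- have -> : dist N n = (n - N.+1).+1 by rewrite /dist; lia.
  have -> : (n - N)%N = (n - N.+1).+1 by lia.
  rewrite !exprS; have : 0 <= rho ^+ (n - N.+1) * (1 - rho) ^+ 2.
    by rewrite mulr_ge0 ?sqr_ge0// exprn_ge0// ltW.
  by rewrite expr2; lra.
- have -> : dist N n = (N - n)%N by rewrite /dist; lia.
  have -> : (N.+1 - n)%N = (N - n).+1 by lia.
  by rewrite exprS; lra.
- rewrite /dist !subnn subSnn expr0 expr1; lra.
Qed.

Lemma nneseries_expr_dist {R : realType} (rho : R) (n : nat) : 0 < rho < 1 ->
  (\sum_(0 <= m <oo) (rho ^+ dist m n)%:E <= (2 / (1 - rho))%:E)%E.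
Proof.
move=> r01; have /andP[r0 _] := r01.
apply: lime_le.
  by apply: is_cvg_nneseries => k _ _; rewrite lee_fin exprn_ge0// ltW.
by apply: nearW => N /=; rewrite sumEFin lee_fin; exact: sum_expr_dist.
Qed.

Section lq_norm_theory.
Context {R : realType}.
Implicit Types (q : \bar R) (b x : nat -> \bar R).

Lemma lq_norm_ge0 q b : (0 < q)%E -> (forall k, 0 <= b k)%E ->
  (0 <= lq_norm q b)%E.
Proof.
case: q => [r| |]//= q0 b0; first exact: poweR_ge0.
by apply: le_ereal_sup_tmp; exists (b 0) => //; exists 0.
Qed.

Lemma le_lq_norm q b x : (0 < q)%E -> (forall k, 0 <= b k)%E ->
  (forall k, b k <= x k)%E -> (lq_norm q b <= lq_norm q x)%E.
Proof.
case: q => [r| |]//= q0 b0 bx.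
  rewrite lte_fin in q0; apply: poweR_mono; first by rewrite invr_ge0 ltW.
    by apply: nneseries_ge0 => n _ _; exact: poweR_ge0.
  apply: lee_nneseries => n _; first by move=> _; exact: poweR_ge0.
  by apply: poweR_mono => //; exact: ltW.
apply/ereal_supP => _ [k _ <-]; apply: le_trans (bx k) _.
by apply: ereal_sup_ubound; exists k.
Qed.

Lemma ereal_supZ (c : R) b : 0 <= c -> (forall k, 0 <= b k)%E ->
  (ereal_sup (range (fun k => c%:E * b k)) = c%:E * ereal_sup (range b))%E.
Proof.
move=> c0 b0; apply/le_anti/andP; split.
  apply/ereal_supP => _ [k _ <-]; apply: lee_wpmul2l; first by rewrite lee_fin.
  by apply: ereal_sup_ubound; exists k.
have [->|cN0] := eqVneq c 0.
  by rewrite mul0e; apply: le_ereal_sup_tmp; exists 0%E => //;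
    exists 0 => //; rewrite mul0e.
have {cN0}c0 : 0 < c by rewrite lt_def cN0.
rewrite -lee_pdivlMl//; apply/ereal_supP => _ [k _ <-].
by rewrite lee_pdivlMl//; apply: ereal_sup_ubound; exists k.
Qed.

Lemma lq_normZ q (c : R) b : (0 < q)%E -> 0 <= c -> (forall k, 0 <= b k)%E ->
  (lq_norm q (fun k => c%:E * b k) = c%:E * lq_norm q b)%E.
Proof.
case: q => [r| |]//= q0 c0 b0; last exact: ereal_supZ.
rewrite lte_fin in q0.
under eq_eseriesr do rewrite poweRM// poweR_EFin.
rewrite nneseriesZl; last by move=> i _; exact: poweR_ge0.
rewrite poweRM; last 2 first.
- by rewrite lee_fin powR_ge0.
- by apply: nneseries_ge0 => n _ _; exact: poweR_ge0.
by rewrite -poweR_EFin poweRK.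
Qed.

Lemma lq_norm_shift q b : (0 < q)%E -> (forall k, 0 <= b k)%E ->
  (lq_norm q (b \o S) <= lq_norm q b)%E.
Proof.
case: q => [r| |]//= q0 b0.
  rewrite lte_fin in q0; apply: poweR_mono; first by rewrite invr_ge0 ltW.
    by apply: nneseries_ge0 => n _ _; exact: poweR_ge0.
  rewrite [leRHS](nneseries_split 0 1)//; last by move=> k _; exact: poweR_ge0.
  rewrite add0n big_nat1 -nneseries_addn; last by move=> k; exact: poweR_ge0.
  under [in leRHS]eq_eseriesr do rewrite addn1.
  by rewrite leeDr//; exact: poweR_ge0.
apply/ereal_supP => _ [k _ <-].
by apply: ereal_sup_ubound; exists k.+1.
Qed.

(* The geometric weight replaces the triangle inequality, which is not
   available for q < 1. *)
Lemma lq_norm_weighted_sup q (rho : R) : (0 < q)%E -> 0 < rho < 1 ->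
  exists2 C : R, 0 < C & forall (n0 : nat) (z : nat -> nat -> \bar R),
  (forall n m, 0 <= z n m)%E ->
  (lq_norm q (fun n => ereal_sup (range (fun m => (rho ^+ dist m n0)%:E * z n m)))
   <= C%:E * ereal_sup (range (fun m => lq_norm q (z ^~ m))))%E.
Proof.
case: q => [r| |]//= q0 r01; have /andP[r0 r1] := r01.
  rewrite lte_fin in q0.
  have s01 : 0 < rho `^ r < 1.
    by rewrite powR_gt0//= -[ltRHS](congr1 (@^~ r) (powR1 R)) gt0_ltr_powR// nnegrE ltW.
  have /andP[s0 s1] := s01.
  set D := 2 / (1 - rho `^ r).
  have D0 : 0 < D by rewrite divr_gt0// subr_gt0.
  (* [D] bounds the series of the r-th powers of the weights, which is geometric of ratio rho^r on
     both sides of [n0]. *)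
  exists (D `^ r^-1); first exact: powR_gt0.
  move=> n0 z z0.
  set S := ereal_sup _.
  have zS m : (\sum_(0 <= n <oo) (z n m) `^ r <= S `^ r)%E.
    rewrite -[leLHS](poweRVK q0)//; last first.
      by apply: nneseries_ge0 => n _ _; exact: poweR_ge0.
    apply: poweR_mono; [exact: ltW|exact: poweR_ge0|].
    by apply: ereal_sup_ubound; exists m.
  have S0 : (0 <= S)%E.
    apply: le_ereal_sup_tmp; eexists; first by exists 0.
    exact: poweR_ge0.
  have w0 m : (0 <= (rho ^+ dist m n0)%:E)%E by rewrite lee_fin exprn_ge0// ltW.
  rewrite -(poweRK q0 S0) -poweR_EFin -poweRM ?poweR_ge0 ?lee_fin//; last first.
    exact: ltW.
  apply: poweR_mono; first by rewrite invr_ge0 ltW.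
    by apply: nneseries_ge0 => n _ _; exact: poweR_ge0.
  (* In r-th powers the supremum over m is at most the sum over m. The two series are then
     interchanged, and each series over n is at most S^r. *)
  apply: (@le_trans _ _ (\sum_(0 <= n <oo) \sum_(0 <= m <oo)
     (((rho `^ r) ^+ dist m n0)%:E * (z n m) `^ r))%E).
    apply: lee_nneseries => n _; first by move=> _; exact: poweR_ge0.
    apply: le_trans (poweR_series_ge_sup _ _) _ => //.
      by move=> m; apply: mule_ge0.
    apply: lee_nneseries => m _; first by move=> _; exact: poweR_ge0.
    by rewrite poweRM// poweR_EFin powR_exprn// ltW.
  rewrite (nneseries_interchange xpredT xpredT); last first.
    move=> i j; apply: mule_ge0; rewrite ?poweR_ge0// lee_fin exprn_ge0//.
    exact: powR_ge0.
  apply: (@le_trans _ _ (\sum_(0 <= m <oo)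
     (S `^ r * ((rho `^ r) ^+ dist m n0)%:E))%E).
    apply: lee_nneseries => m _.
      move=> _; apply: nneseries_ge0 => n _ _; apply: mule_ge0; rewrite ?poweR_ge0//.
      by rewrite lee_fin exprn_ge0// powR_ge0.
    rewrite nneseriesZl; last by move=> i _; exact: poweR_ge0.
    rewrite muleC; apply: lee_wpmul2r => //.
    by rewrite lee_fin exprn_ge0// powR_ge0.
  rewrite [leRHS]muleC.
  (* Only a finite factor is pulled out of the series, so an infinite [S] is treated apart. *)
  have [->|] := eqVneq S +oo%E.
    by rewrite poweRyr ?gt_eqF// gt0_mulye ?leey// lte_fin.
  move=> Sy; have Sf : (S `^ r)%E \is a fin_num.
    by apply: fin_num_poweR; rewrite ge0_fin_numE// ltey.
  rewrite -(fineK Sf) nneseriesZl; last first.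
    by move=> i _; rewrite lee_fin exprn_ge0// powR_ge0.
  apply: lee_wpmul2l; last exact: nneseries_expr_dist.
  by rewrite fineK// poweR_ge0.
exists 1 => // n0 z z0; rewrite mul1e.
apply/ereal_supP => _ [n _ <-]; apply/ereal_supP => _ [m _ <-].
apply: (@le_trans _ _ (z n m)).
  by rewrite gee_pMl// lee_fin ?exprn_ge0 ?exprn_ile1// ltW.
apply: le_ereal_sup_tmp; eexists; first by exists m.
by apply: ereal_sup_ubound; exists n.
Qed.

(** A Young-type inequality with a supremum in place of the convolution sum. In r-th powers the
    supremum is at most the sum, and after interchanging the series each [x m] carries total weight
    at most [D]. *)
Lemma lq_norm_convolution_sup q (rho : R) : (0 < q)%E -> 0 < rho < 1 ->
  exists2 C : R, 0 < C & forall x : nat -> \bar R,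
  (forall n, 0 <= x n)%E ->
  (lq_norm q (fun n => ereal_sup (range (fun m => (rho ^+ dist m n)%:E * x m)))
   <= C%:E * lq_norm q x)%E.
Proof.
case: q => [r| |]//= q0 r01; have /andP[r0 r1] := r01.
  rewrite lte_fin in q0.
  have s01 : 0 < rho `^ r < 1.
    by rewrite powR_gt0//= -[ltRHS](congr1 (@^~ r) (powR1 R)) gt0_ltr_powR// nnegrE ltW.
  have /andP[s0 s1] := s01.
  set D := 2 / (1 - rho `^ r).
  have D0 : 0 < D by rewrite divr_gt0// subr_gt0.
  exists (D `^ r^-1); first exact: powR_gt0.
  move=> x x0.
  have w0 m n : (0 <= (rho ^+ dist m n)%:E)%E by rewrite lee_fin exprn_ge0// ltW.
  have v0 m n : (0 <= ((rho `^ r) ^+ dist m n)%:E)%E.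
    by rewrite lee_fin exprn_ge0// powR_ge0.
  rewrite -poweR_EFin -poweRM; last 2 first.
    by rewrite lee_fin ltW.
    by apply: nneseries_ge0 => n _ _; exact: poweR_ge0.
  apply: poweR_mono; first by rewrite invr_ge0 ltW.
    by apply: nneseries_ge0 => n _ _; exact: poweR_ge0.
  apply: (@le_trans _ _ (\sum_(0 <= n <oo) \sum_(0 <= m <oo)
     (((rho `^ r) ^+ dist m n)%:E * (x m) `^ r))%E).
    apply: lee_nneseries => n _; first by move=> _; exact: poweR_ge0.
    apply: le_trans (poweR_series_ge_sup _ _) _ => //.
      by move=> m; apply: mule_ge0.
    apply: lee_nneseries => m _; first by move=> _; exact: poweR_ge0.
    by rewrite poweRM// poweR_EFin powR_exprn// ltW.
  rewrite (nneseries_interchange xpredT xpredT); last first.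
    by move=> i j; apply: mule_ge0; rewrite ?poweR_ge0.
  rewrite -nneseriesZl; last by move=> i _; exact: poweR_ge0.
  apply: lee_nneseries => m _.
    by move=> _; apply: nneseries_ge0 => n _ _; apply: mule_ge0; rewrite ?poweR_ge0.
  under eq_eseriesr do rewrite muleC dist_sym.
  have [->|] := eqVneq (x m) +oo%E.
    by rewrite poweRyr ?gt_eqF// gt0_muley ?leey.
  move=> Sy; have Sf : (x m `^ r)%E \is a fin_num.
    by apply: fin_num_poweR; rewrite ge0_fin_numE// ltey.
  rewrite [leRHS]muleC -(fineK Sf) nneseriesZl//.
  apply: lee_wpmul2l; last exact: nneseries_expr_dist.
  by rewrite fineK// poweR_ge0.
exists 1 => // x x0; rewrite mul1e.
apply/ereal_supP => _ [n _ <-]; apply/ereal_supP => _ [m _ <-].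
apply: (@le_trans _ _ (x m)).
  by rewrite gee_pMl// lee_fin ?exprn_ge0 ?exprn_ile1// ltW.
by apply: ereal_sup_ubound; exists m.
Qed.

End lq_norm_theory.

(** * Dyadic discretization of the dt/t norm *)

(* Unlike ge0_le_integral, no measurability is required. *)
Lemma ge0_le_lower_integral {d} {T : measurableType d} {R : realType}
    (mu : {measure set T -> \bar R}) (D : set T) (f g : T -> \bar R) :
  (forall x, D x -> (0 <= f x)%E) -> (forall x, D x -> (f x <= g x)%E) ->
  (\int[mu]_(x in D) f x <= \int[mu]_(x in D) g x)%E.
Proof.
move=> f0 fg; have g0 x : D x -> (0 <= g x)%E.
  by move=> Dx; apply: le_trans (f0 _ Dx) (fg _ Dx).
rewrite !ge0_integralE//; apply: ereal_sup_le => _ [h /= hf <-].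
exists h => // x; apply: le_trans (hf x) _; rewrite !patchE.
by case: ifPn => // /set_mem; exact: fg.
Qed.

Section dyadic_shells.
Context {R : realType}.
Implicit Types (q : \bar R) (b c : nat -> \bar R) (phi : R -> \bar R).

(** Half-open, so that the shells partition (0, 1]. *)
Definition dyadic_shell (k : nat) : set R := `]2^-1 ^+ k.+1, 2^-1 ^+ k]%classic.

Lemma dyadic_shellP (k : nat) (t : R) :
  dyadic_shell k t <-> 2^-1 ^+ k.+1 < t <= 2^-1 ^+ k.
Proof. by rewrite /dyadic_shell /= in_itv. Qed.

Lemma expr_half_gt0 (k : nat) : 0 < 2^-1 ^+ k :> R.
Proof. by rewrite exprn_gt0. Qed.

Lemma expr_half_le (k m : nat) : (k <= m)%N -> 2^-1 ^+ m <= 2^-1 ^+ k :> R.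
Proof. by move=> km; rewrite ler_wiXn2l ?invr_ge0// invf_le1// ler1n. Qed.

Lemma dyadic_shell_inj (k m : nat) (t : R) :
  dyadic_shell k t -> dyadic_shell m t -> k = m.
Proof.
move=> /dyadic_shellP/andP[k1 k2] /dyadic_shellP/andP[m1 m2].
case: (ltngtP k m) => // km.
- by have := lt_le_trans k1 (le_trans m2 (expr_half_le km)); rewrite ltxx.
- by have := lt_le_trans m1 (le_trans k2 (expr_half_le km)); rewrite ltxx.
Qed.

Lemma expr_half_arch (e : R) : 0 < e -> exists k, 2^-1 ^+ k < e.
Proof.
move=> e0; have [n] : exists n : nat, e^-1 < n%:R.
  by exists (Num.truncn e^-1).+1; exact: truncnS_gt.
move=> en; exists n; rewrite exprVn invf_plt ?posrE ?exprn_gt0//.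
apply: lt_trans en _; rewrite -natrX ltr_nat; exact: ltn_expl.
Qed.

Lemma dyadic_shell_cover (t : R) : 0 < t <= 1 -> exists k, dyadic_shell k t.
Proof.
move=> /andP[t0 t1]; have [k0 k0t] := expr_half_arch t0.
have ex : exists k, 2^-1 ^+ k.+1 < t.
  by exists k0; apply: le_lt_trans k0t; exact: expr_half_le.
have [k kt kmin] := ex_minnP ex; exists k; apply/dyadic_shellP.
rewrite kt /=; case: k kt kmin => [|k] _ kmin; first by rewrite expr0.
by rewrite leNgt; apply/negP => /kmin; rewrite ltnn.
Qed.

Lemma dyadic_shell_gt0 k (t : R) : dyadic_shell k t -> 0 < t <= 1.
Proof.
move=> /dyadic_shellP/andP[k1 k2].
rewrite (lt_trans (expr_half_gt0 _) k1)/= (le_trans k2)//.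
by rewrite -(expr0 2^-1) expr_half_le.
Qed.

(** At each point at most one term is nonzero. The form of a series allows integration term by
    term. *)
Definition dyadic_step c (t : R) : \bar R :=
  (\sum_(0 <= k <oo) c k * (\1_(dyadic_shell k) t)%:E)%E.

Lemma dyadic_stepE c k t : dyadic_shell k t -> dyadic_step c t = c k.
Proof.
move=> kt; have H m : m <> k -> (\1_(dyadic_shell m) t) = 0 :> R.
  by move=> mk; rewrite indicE memNset// => /dyadic_shell_inj /(_ kt).
rewrite /dyadic_step; apply: lim_near_cst => //.
exists k.+1 => // n /= kn.
rewrite (big_cat_nat (leq0n _) kn)//= big_nat_recr//= big1_seq; last first.
  move=> i /andP[_]; rewrite mem_index_iota => /andP[_ ik].
  by rewrite H ?mule0//; lia.
rewrite big1_seq; last first.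
  move=> i /andP[_]; rewrite mem_index_iota => /andP[ki _].
  by rewrite H ?mule0//; lia.
by rewrite indicE mem_set// mule1 adde0 add0e.
Qed.

Lemma dyadic_step_eq0 c t : 1 < t -> dyadic_step c t = 0%E.
Proof.
move=> t1; rewrite /dyadic_step eseries0// => m _ _.
rewrite indicE memNset ?mule0// => /dyadic_shell_gt0.
by rewrite leNgt t1 andbF.
Qed.

Lemma integral_dyadic_step c : (forall k, (0 <= c k)%E) ->
  (\int[@lebesgue_measure R]_(t in `]0%R, +oo[) dyadic_step c t =
   \sum_(0 <= k <oo) c k * (2^-1 ^+ k.+1)%:E)%E.
Proof.
move=> c0; rewrite integral_nneseries//=; last 2 first.
- move=> n; apply: emeasurable_funM => //.
  by apply/measurable_EFinP; apply: measurable_indic; exact: measurable_itv.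
- by move=> n t _; apply: mule_ge0 => //; rewrite lee_fin.
apply: eq_eseriesr => k _; rewrite ge0_integralZl//=; last first.
  by apply/measurable_EFinP; apply: measurable_indic; exact: measurable_itv.
rewrite integral_indic//; last exact: measurable_itv.
rewrite setIidl; last first.
  by move=> t /dyadic_shell_gt0/andP[t0 _]; rewrite /= in_itv/= t0.
transitivity (c k * @lebesgue_measure R (dyadic_shell k))%E => //.
rewrite /dyadic_shell lebesgue_measure_itv/= lte_fin -EFinD.
have -> : 2^-1 ^+ k.+1 < 2^-1 ^+ k :> R by rewrite exprS; have := expr_half_gt0 k; lra.
congr (_ * _%:E)%E; rewrite exprS; lra.
Qed.

(** On shell k the factor 1/t is at least 2^k and the length is 2^(-k-1), so the shell has dt/t mass
    at least 1/2; hence the constant (1/2)^(1/r). It depends on [q] alone, which matters when the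
    two norms are nested. *)
Lemma lq_norm_le_Lq q : (0 < q)%E -> exists2 c : R, 0 < c & forall b phi,
  (forall k, 0 <= b k)%E -> (forall t, 0 < t -> (0 <= phi t)%E) ->
  (forall k t, dyadic_shell k t -> (b k <= phi t)%E) ->
  (c%:E * lq_norm q b <= Lq_dt_over_t_norm q phi)%E.
Proof.
case: q => [r| |]//= q0; last first.
  exists 1 => // b phi b0 phi0 bphi; rewrite mul1e.
  apply/ereal_supP => _ [k _ <-].
  have kt : dyadic_shell k (2^-1 ^+ k).
    by apply/dyadic_shellP; rewrite lexx andbT exprS; have := expr_half_gt0 k; lra.
  apply: le_ereal_sup_tmp; exists (phi (2^-1 ^+ k)); last exact: bphi.
  by exists (2^-1 ^+ k) => //; rewrite /= in_itv/= expr_half_gt0.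
rewrite lte_fin in q0; exists (2^-1 `^ r^-1); first exact: powR_gt0.
move=> b phi b0 phi0 bphi.
rewrite -poweR_EFin -poweRM ?lee_fin//; last first.
  by apply: nneseries_ge0 => n _ _; exact: poweR_ge0.
apply: poweR_mono; first by rewrite invr_ge0 ltW.
  apply: mule_ge0; rewrite ?lee_fin//.
  by apply: nneseries_ge0 => n _ _; exact: poweR_ge0.
pose c k := (b k `^ r * (2 ^+ k)%:E)%E.
have c0 k : (0 <= c k)%E by rewrite mule_ge0 ?poweR_ge0// lee_fin exprn_ge0.
rewrite -nneseriesZl; last by move=> i _; exact: poweR_ge0.
rewrite [leLHS](_ : _ =
    (\int[@lebesgue_measure R]_(t in `]0%R, +oo[) dyadic_step c t)%E); last first.
  rewrite integral_dyadic_step//; apply: eq_eseriesr => k _.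
  rewrite /c -muleA -EFinM muleC exprS mulrCA -exprMn.
  by rewrite mulfV// expr1n mulr1.
apply: ge0_le_lower_integral => t; rewrite /= in_itv/= andbT => t0.
  by apply: nneseries_ge0 => n _ _; apply: mule_ge0 => //; rewrite lee_fin.
have [t1|t1] := ltP 1 t.
  rewrite dyadic_step_eq0// mule_ge0 ?poweR_ge0// lee_fin invr_ge0 ltW//.
have [k kt] := @dyadic_shell_cover t (introT andP (conj t0 t1)).
rewrite (dyadic_stepE _ kt) /c; apply: lee_pmul.
- exact: poweR_ge0.
- by rewrite lee_fin exprn_ge0.
- by apply: poweR_mono => //; [exact: ltW|exact: bphi].
- move/dyadic_shellP : kt => /andP[_ kt].
  rewrite lee_fin -[leLHS]invrK lef_pV2 ?posrE//; first by rewrite -exprVn.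
Qed.

(** Here 1/t is at most 2^(k+1) on a shell of length 2^(-k-1), so the constant is 1. The shells
    exhaust only (0, 1], whence the condition that [phi] vanish beyond 1. *)
Lemma Lq_le_lq_norm q b phi : (0 < q)%E ->
  (forall k, 0 <= b k)%E -> (forall t, 0 < t -> (0 <= phi t)%E) ->
  (forall k t, dyadic_shell k t -> (phi t <= b k)%E) ->
  (forall t, 1 < t -> phi t = 0%E) ->
  (Lq_dt_over_t_norm q phi <= lq_norm q b)%E.
Proof.
case: q => [r| |]//= q0 b0 phi0 phib phi1; last first.
  apply/ereal_supP => _ [t + <-]; rewrite /= in_itv/= andbT => t0.
  have [t1|t1] := ltP 1 t.
    by rewrite phi1//; apply: le_ereal_sup_tmp; exists (b 0) => //; exists 0.
  have [k kt] := @dyadic_shell_cover t (introT andP (conj t0 t1)).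
  by apply: le_ereal_sup_tmp; exists (b k); [exists k|exact: phib].
rewrite lte_fin in q0.
have h0 t : 0 < t -> (0 <= phi t `^ r * (t^-1)%:E)%E.
  by move=> t0; rewrite mule_ge0 ?poweR_ge0// lee_fin invr_ge0 ltW.
apply: poweR_mono; first by rewrite invr_ge0 ltW.
  by apply: integral_ge0 => t; rewrite /= in_itv/= andbT => /h0.
pose c k := (b k `^ r * (2 ^+ k.+1)%:E)%E.
have c0 k : (0 <= c k)%E by rewrite mule_ge0 ?poweR_ge0// lee_fin exprn_ge0.
rewrite [leRHS](_ : _ =
    (\int[@lebesgue_measure R]_(t in `]0%R, +oo[) dyadic_step c t)%E); last first.
  rewrite integral_dyadic_step//; apply: eq_eseriesr => k _.
  by rewrite /c -muleA -EFinM -exprMn mulfV// expr1n mule1.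
apply: ge0_le_lower_integral => t; rewrite /= in_itv/= andbT => t0.
  exact: h0.
have [t1|t1] := ltP 1 t.
  by rewrite phi1// poweR0r ?gt_eqF// mul0e dyadic_step_eq0.
have [k kt] := @dyadic_shell_cover t (introT andP (conj t0 t1)).
rewrite (dyadic_stepE _ kt) /c; apply: lee_pmul.
- exact: poweR_ge0.
- by rewrite lee_fin invr_ge0 ltW.
- by apply: poweR_mono; [exact: ltW|exact: phi0|exact: phib].
- move/dyadic_shellP : kt => /andP[kt _].
  rewrite lee_fin -[leRHS]invrK lef_pV2 ?posrE//.
by rewrite -exprVn ltW.
Qed.

End dyadic_shells.

(** * Bilinear integrals on the unit square *)

Section bounded_measurable.
Context {R : realType}.
Implicit Types u v : R -> R.

Definition bounded_measurable u :=
  measurable_fun setT u /\ exists C, forall x, `|u x| <= C.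

Lemma bounded_measurable_indic (A : set R) :
  measurable A -> bounded_measurable (\1_A : R -> R).
Proof.
move=> mA; split; first exact: measurable_indic.
by exists 1 => x; rewrite indicE; case: (_ \in _); rewrite ?normr1 ?normr0.
Qed.

Lemma bounded_measurable_cst (c : R) : bounded_measurable (fun=> c).
Proof. by split; [exact: measurable_cst|exists `|c| => x]. Qed.

Lemma bounded_measurableD u v : bounded_measurable u -> bounded_measurable v ->
  bounded_measurable (fun x => u x + v x).
Proof.
move=> [mu [C hC]] [mv [D hD]]; split; first exact: measurable_funD.
by exists (C + D) => x; apply: le_trans (ler_normD _ _) (lerD _ _).
Qed.

Lemma bounded_measurableZ (c : R) u : bounded_measurable u ->
  bounded_measurable (fun x => c * u x).
Proof.
move=> [mu [C hC]]; split; first exact: measurable_funM.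
by exists (`|c| * C) => x; rewrite normrM ler_wpM2l.
Qed.

Lemma bounded_measurable_sum (I : Type) (s : seq I) (P : pred I) (u : I -> R -> R) :
  (forall i, P i -> bounded_measurable (u i)) ->
  bounded_measurable (fun x => \sum_(i <- s | P i) u i x).
Proof.
move=> mu; elim: s => [|i s IH].
  under eq_fun do rewrite big_nil; exact: bounded_measurable_cst.
under eq_fun do rewrite big_cons.
case: (boolP (P i)) => Pi //; apply: bounded_measurableD => //; exact: mu.
Qed.

End bounded_measurable.

Section bilinear_integral.
Context {R : realType}.
Implicit Types (f : R * R -> R) (u v : R -> R).

Notation sq := (`[0%R, 1%R]%classic `*` `[0%R, 1%R]%classic : set (R * R)).

(** Haar coefficients and integrals over rectangles are both values of this form, at Haar functions
    and at indicators respectively. *)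
Definition bil f u v : R :=
  \int[lebesgue2 R]_(x in `[0, 1] `*` `[0, 1]) (f x * u x.1 * v x.2).

Lemma measurable_sq : measurable sq.
Proof. by apply: measurableX; exact: measurable_itv. Qed.

Lemma measurable_tensor u v : bounded_measurable u -> bounded_measurable v ->
  measurable_fun setT (fun x : R * R => u x.1 * v x.2).
Proof.
move=> [mu _] [mv _]; apply: measurable_funM.
  by apply: (measurableT_comp mu); exact: measurable_fst.
by apply: (measurableT_comp mv); exact: measurable_snd.
Qed.

Lemma integrable_bil f u v : L1_unit_square f ->
  bounded_measurable u -> bounded_measurable v ->
  (lebesgue2 R).-integrable sq (EFin \o (fun x => f x * u x.1 * v x.2)).
Proof.
move=> hf bu bv; have [[_ [C hC]] [_ [D hD]]] := (bu, bv).
have := @integrableMl _ _ _ (lebesgue2 R) sq measurable_sq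
  (EFin \o f) (fun x => u x.1 * v x.2) hf.
move=> /(_ _ _)/eq_integrable; apply => //.
- exact: measurable_sq.
- by move=> x _ /=; rewrite -EFinM mulrA.
- by apply: measurable_funS (measurable_tensor bu bv).
- exists (C * D); split; first exact: num_real.
  move=> y Cy x _ /=; apply: le_trans (ltW Cy).
  by rewrite normrM ler_pM.
Qed.

Lemma bilDl f u u' v : L1_unit_square f ->
  bounded_measurable u -> bounded_measurable u' -> bounded_measurable v ->
  bil f (fun x => u x + u' x) v = bil f u v + bil f u' v.
Proof.
move=> hf bu bu' bv; rewrite /bil -RintegralD//; last 3 first.
- exact: measurable_sq.
- exact: integrable_bil.
- exact: integrable_bil.
by apply: eq_Rintegral => x _; lra.
Qed.

Lemma bilDr f u v v' : L1_unit_square f ->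
  bounded_measurable u -> bounded_measurable v -> bounded_measurable v' ->
  bil f u (fun x => v x + v' x) = bil f u v + bil f u v'.
Proof.
move=> hf bu bv bv'; rewrite /bil -RintegralD//; last 3 first.
- exact: measurable_sq.
- exact: integrable_bil.
- exact: integrable_bil.
by apply: eq_Rintegral => x _; lra.
Qed.

Lemma bilZl f (c : R) u v : L1_unit_square f ->
  bounded_measurable u -> bounded_measurable v ->
  bil f (fun x => c * u x) v = c * bil f u v.
Proof.
move=> hf bu bv; rewrite /bil -RintegralZl//; last 2 first.
- exact: measurable_sq.
- exact: integrable_bil.
by apply: eq_Rintegral => x _; lra.
Qed.

Lemma bilZr f (c : R) u v : L1_unit_square f ->
  bounded_measurable u -> bounded_measurable v ->
  bil f u (fun x => c * v x) = c * bil f u v.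
Proof.
move=> hf bu bv; rewrite /bil -RintegralZl//; last 2 first.
- exact: measurable_sq.
- exact: integrable_bil.
by apply: eq_Rintegral => x _; lra.
Qed.

Lemma bil_suml (I : Type) (s : seq I) (c : I -> R) (u : I -> R -> R) f v :
  L1_unit_square f ->
  (forall i, bounded_measurable (u i)) -> bounded_measurable v ->
  bil f (fun x => \sum_(i <- s) c i * u i x) v = \sum_(i <- s) c i * bil f (u i) v.
Proof.
move=> hf bu bv; elim: s => [|i s IH].
  rewrite big_nil -[RHS](mul0r (bil f (fun=> 0) v)) -bilZl//.
    by rewrite /bil; apply: eq_Rintegral => x _; rewrite big_nil mul0r.
  exact: bounded_measurable_cst.
rewrite big_cons -IH -bilZl// -bilDl//; last 2 first.
- exact: bounded_measurableZ.
- by apply: bounded_measurable_sum => j _; exact: bounded_measurableZ.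
by rewrite /bil; apply: eq_Rintegral => x _; rewrite big_cons.
Qed.

Lemma bil_sumr (I : Type) (s : seq I) (c : I -> R) (v : I -> R -> R) f u :
  L1_unit_square f ->
  bounded_measurable u -> (forall i, bounded_measurable (v i)) ->
  bil f u (fun x => \sum_(i <- s) c i * v i x) = \sum_(i <- s) c i * bil f u (v i).
Proof.
move=> hf bu bv; elim: s => [|i s IH].
  rewrite big_nil -[RHS](mul0r (bil f u (fun=> 0))) -bilZr//.
    by rewrite /bil; apply: eq_Rintegral => x _; rewrite big_nil mul0r.
  exact: bounded_measurable_cst.
rewrite big_cons -IH -bilZr// -bilDr//; last 2 first.
- exact: bounded_measurableZ.
- by apply: bounded_measurable_sum => j _; exact: bounded_measurableZ.
by rewrite /bil; apply: eq_Rintegral => x _; rewrite big_cons.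
Qed.

(** A countable set is null, and a strip over it has measure 0 although its other side is infinite,
    since 0 times +oo is 0. *)
Lemma lebesgue2_negligible_cross (D : set R) : countable D ->
  (lebesgue2 R).-negligible [set x | D x.1 \/ D x.2].
Proof.
move=> cD; have mD : measurable D by exact: countable_measurable.
exists ((D `*` setT) `|` (setT `*` D)); split.
- by apply: measurableU; apply: measurableX.
- have D0 : @lebesgue_measure R D = 0%E := countable_lebesgue_measure0 cD.
  have H1 : lebesgue2 R (D `*` setT) = 0%E.
    transitivity (@lebesgue_measure R D * @lebesgue_measure R setT)%E.
      exact: product_measure1E.
    by rewrite D0 mul0e.
  have H2 : lebesgue2 R (setT `*` D) = 0%E.
    transitivity (@lebesgue_measure R setT * @lebesgue_measure R D)%E.
      exact: product_measure1E.
    by rewrite D0 mule0.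
  rewrite measureU0//; exact: measurableX.
- by move=> x [Dx|Dx]; [left|right].
Qed.

(** This permits replacing the open intervals in [haar] by segments and ignoring the values at
    jumps. *)
Lemma eq_bil_countable (D : set R) f u u' v v' : L1_unit_square f ->
  countable D ->
  bounded_measurable u -> bounded_measurable u' ->
  bounded_measurable v -> bounded_measurable v' ->
  (forall x, 0 <= x <= 1 -> ~ D x -> u x = u' x) ->
  (forall x, 0 <= x <= 1 -> ~ D x -> v x = v' x) ->
  bil f u v = bil f u' v'.
Proof.
move=> hf cD bu bu' bv bv' uu' vv'.
have iu := integrable_bil hf bu bv; have iu' := integrable_bil hf bu' bv'.
rewrite /bil /Rintegral; congr fine; apply: ae_eq_integral.
- exact: measurable_sq.
- exact: measurable_int iu.
- exact: measurable_int iu'.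
have := lebesgue2_negligible_cross cD; apply: negligibleS => x /= nx.
apply: contrapT => /not_orP[D1 D2]; apply: nx => -[/= x1 x2].
by rewrite uu' ?vv' //; move: x1 x2; rewrite !in_itv.
Qed.

Lemma bil_indic f (I J : set R) : measurable I -> measurable J ->
  I `<=` `[0, 1] -> J `<=` `[0, 1] ->
  bil f \1_I \1_J = \int[lebesgue2 R]_(x in I `*` J) f x.
Proof.
move=> mI mJ I1 J1; rewrite /bil.
rewrite [RHS](_ : _ = \int[lebesgue2 R]_(x in sq `&` (I `*` J)) f x).
  rewrite [RHS]Rintegral_mkcondr; apply: eq_Rintegral => x _; rewrite patchE !indicE.
  have [/set_mem[xI xJ]|xIJ] := boolP (x \in I `*` J).
    by rewrite !mem_set// !mulr1.
  have [/set_mem xI|_] := boolP (x.1 \in I); last by rewrite mulr0 mul0r.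
  have [/set_mem xJ|_] := boolP (x.2 \in J); last by rewrite mulr0.
  by exfalso; move/negP: xIJ; apply; apply/mem_set.
by congr Rintegral; rewrite setIidr// => x [/I1 ? /J1 ?].
Qed.

End bilinear_integral.

(** * Haar coefficients and net averages *)

Section haar_functions.
Context {R : realType}.
Implicit Types (f : R * R -> R) (a b x y : R).

Lemma powR2D (s t : R) : 2 `^ (s + t) = 2 `^ s * 2 `^ t :> R.
Proof. by rewrite powRD// pnatr_eq0 implybT. Qed.

Lemma haar_height_sqr (k : nat) : 2 `^ (k%:R / 2) * 2 `^ (k%:R / 2) = 2 ^+ k :> R.
Proof.
rewrite -powR2D -powR_mulrn//; congr (_ `^ _); lra.
Qed.

Lemma haar_height_ge1 (k : nat) : 1 <= 2 `^ (k%:R / 2) :> R.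
Proof.
by rewrite -[leLHS](powRr0 2) ler_powR ?ler1n// divr_ge0.
Qed.

Lemma haarE (k j : nat) x : j != 0%N -> haar k j x = 2 `^ (k%:R / 2) *
  (\1_(`]((2 * j)%:R - 2) / 2 ^+ k.+1, ((2 * j)%:R - 1) / 2 ^+ k.+1[%classic) x -
   \1_(`]((2 * j)%:R - 1) / 2 ^+ k.+1, (2 * j)%:R / 2 ^+ k.+1[%classic) x).
Proof.
move=> /negPf j0; rewrite /haar j0 !indicE.
have p : 0 < 2 ^+ k.+1 :> R by rewrite exprn_gt0.
case: ifPn => [h1|h1].
  rewrite mem_set; last by rewrite /= in_itv.
  rewrite memNset; first by rewrite subr0 mulr1.
  by rewrite /= in_itv/= => /andP[+ _]; case/andP: h1 => _ /lt_trans/[apply]; rewrite ltxx.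
rewrite memNset; last by rewrite /= in_itv/=; exact/negP.
case: ifPn => h2; first by rewrite mem_set ?sub0r ?mulrN1// /= in_itv.
by rewrite memNset ?subr0 ?mulr0// /= in_itv/=; exact/negP.
Qed.

Lemma haar0 (k : nat) x : haar k 0 x = 1.
Proof. by []. Qed.

Lemma bounded_measurable_haar (k j : nat) :
  bounded_measurable (haar k j : R -> R).
Proof.
have [->|j0] := eqVneq j 0%N; first exact: bounded_measurable_cst.
rewrite (funext (fun x => haarE k x j0)).
apply: bounded_measurableZ; apply: bounded_measurableD.
  by apply: bounded_measurable_indic; exact: measurable_itv.
under eq_fun do rewrite -mulN1r.
by apply: bounded_measurableZ; apply: bounded_measurable_indic; exact: measurable_itv.
Qed.

Definition dyadic : set R := [set x | exists k i : nat, x = i%:R / 2 ^+ k].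

Lemma countable_dyadic : countable dyadic.
Proof.
suff -> : dyadic = range (fun p : nat * nat => p.2%:R / 2 ^+ p.1).
  exact: sub_countable (card_image_le _ _) (countableP _).
apply/seteqP; split => x /=.
  by move=> [k [i ->]]; exists (k, i).
by move=> [[k i] _ <-]; exists k, i.
Qed.

(** The constant function is cut into two halves as well, so that one argument covers every index.
    Dyadic points are excluded because segments replace open intervals with dyadic endpoints. *)
Lemma haar_split (k j : nat) : haar_level_full k j ->
  exists (a e1 e2 : R), [/\ 0 <= a, a + 2^-1 ^+ k <= 1,
    `|e1| = 2 `^ (k%:R / 2), `|e2| = 2 `^ (k%:R / 2) &
    forall x, 0 <= x <= 1 -> ~ dyadic x -> haar k j x =
      e1 * \1_(`[a, a + 2^-1 ^+ k.+1]%classic) x +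
      e2 * \1_(`[a + 2^-1 ^+ k.+1, a + 2^-1 ^+ k]%classic) x].
Proof.
have p : 0 < 2 ^+ k.+1 :> R by rewrite exprn_gt0.
case => [jk|[-> ->]]; last first.
  exists 0, 1, 1; rewrite add0r expr0 mul0r powRr0 !normr1; split => // x x01 xD.
  rewrite haar0 !mul1r !indicE expr1 add0r.
  have x2 : x != 2^-1 by apply/eqP => xE; apply: xD; exists 1%N, 1%N; rewrite mul1r.
  have [xl|xl] := ltP x 2^-1.
    rewrite mem_set; last by rewrite /= in_itv/=; lra.
    by rewrite memNset ?addr0// /= in_itv/=; lra.
  have {x2 xl}xl : 2^-1 < x by rewrite lt_def x2.
  rewrite memNset ?add0r; last by rewrite /= in_itv/=; lra.
  by rewrite mem_set// /= in_itv/=; lra.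
have /andP[j1 j2k] := jk.
have j0 : j != 0%N by rewrite -lt0n.
have mE (z : R) : z / 2 ^+ k.+1 = z * 2^-1 ^+ k.+1 by rewrite exprVn.
have kS : 2^-1 ^+ k = 2 * 2^-1 ^+ k.+1 :> R by rewrite exprS; lra.
have rE : 2 ^+ k.+1 * 2^-1 ^+ k.+1 = 1 :> R by rewrite exprVn divff// gt_eqF.
have r0 : 0 < 2^-1 ^+ k.+1 :> R := expr_half_gt0 _.
exists (((2 * j)%:R - 2) / 2 ^+ k.+1), (2 `^ (k%:R / 2)), (- 2 `^ (k%:R / 2)).
rewrite normrN ger0_norm ?powR_ge0//.
have j1R : 1 <= j%:R :> R by rewrite ler1n.
have j2R : j%:R <= 2 ^+ k :> R by rewrite -natrX ler_nat.
split => //.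
- by apply: divr_ge0; [rewrite natrM; lra|exact: ltW].
- rewrite mE kS -mulrDl -[leRHS]rE ler_pM2r// natrM exprS; lra.
move=> x x01 xD; rewrite haarE// mulrBr mulNr !indicE.
have l1 : ((2 * j)%:R - 2) / 2 ^+ k.+1 != x.
  apply/eqP => xE; apply: xD; exists k.+1, (2 * j - 2)%N.
  by rewrite natrB//; lia.
have l2 : ((2 * j)%:R - 1) / 2 ^+ k.+1 != x.
  apply/eqP => xE; apply: xD; exists k.+1, (2 * j - 1)%N.
  by rewrite natrB//; lia.
have l3 : (2 * j)%:R / 2 ^+ k.+1 != x.
  by apply/eqP => xE; apply: xD; exists k.+1, (2 * j)%N.
have e2 : ((2 * j)%:R - 2) / 2 ^+ k.+1 + 2^-1 ^+ k.+1 =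
          ((2 * j)%:R - 1) / 2 ^+ k.+1 :> R by rewrite !mE; lra.
have e3 : ((2 * j)%:R - 2) / 2 ^+ k.+1 + 2^-1 ^+ k =
          (2 * j)%:R / 2 ^+ k.+1 :> R by rewrite kS !mE; lra.
rewrite e2 e3; congr (_ * (nat_of_bool _)%:R - _ * (nat_of_bool _)%:R).
- apply/idP/idP => /set_mem; rewrite /= in_itv/= => h; apply/mem_set;
    rewrite /= in_itv/=; last by rewrite !lt_neqAle l1 eq_sym l2.
  by case/andP: h => /ltW -> /ltW ->.
- apply/idP/idP => /set_mem; rewrite /= in_itv/= => h; apply/mem_set;
    rewrite /= in_itv/=; last by rewrite !lt_neqAle l2 eq_sym l3.
  by case/andP: h => /ltW -> /ltW ->.
Qed.

Lemma len_segment a b : a < b -> len (`[a, b]%classic : set R) = b - a.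
Proof.
by move=> ab; rewrite /len lebesgue_measure_itv/= lte_fin ab -EFinD.
Qed.

Lemma net_average_ge0 M f t1 t2 : (0 <= net_average M f t1 t2)%E.
Proof. by apply: ereal_sup_ubound; left. Qed.

Lemma integral_le_net_average f (Q : set R * set R) t1 t2 :
  unit_square_rectangles Q -> t1 <= len Q.1 -> t2 <= len Q.2 ->
  (`|\int[lebesgue2 R]_(x in Q.1 `*` Q.2) f x|%:E <=
   (len Q.1 * len Q.2)%:E * net_average unit_square_rectangles f t1 t2)%E.
Proof.
move=> MQ t1Q t2Q; have [[a1 [b1 [ab1 E1]]] [a2 [b2 [ab2 E2]]] _ _] := MQ.
have l0 : 0 < len Q.1 * len Q.2.
  by rewrite E1 E2 !len_segment// mulr_gt0// subr_gt0.
rewrite -lee_pdivrMl// -EFinM; apply: ereal_sup_ubound; right.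
by exists Q.
Qed.

(** Each of the four rectangles has area 2^(-k1-1) 2^(-k2-1). The Haar heights contribute 2^(k1/2)
    2^(k2/2), the weight on the left contributes the same again, and 4 times 2^k1 2^k2 times the
    area is exactly 1. *)
Lemma haar_coef_le_net_average f k1 k2 j1 j2 : L1_unit_square f ->
  haar_level_full k1 j1 -> haar_level_full k2 j2 ->
  ((2 `^ (k1%:R / 2) * 2 `^ (k2%:R / 2) * `|haar_coef f k1 k2 j1 j2|)%:E <=
   net_average unit_square_rectangles f (2^-1 ^+ k1.+1) (2^-1 ^+ k2.+1))%E.
Proof.
move=> hf /haar_split[a1 [d1 [e1 [a10 a11 nd1 ne1 h1]]]].
move=> /haar_split[a2 [d2 [e2 [a20 a21 nd2 ne2 h2]]]].
have half1 : 2^-1 ^+ k1 = 2 * 2^-1 ^+ k1.+1 :> R by rewrite exprS; lra.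
have half2 : 2^-1 ^+ k2 = 2 * 2^-1 ^+ k2.+1 :> R by rewrite exprS; lra.
set I1 := `[a1, _]%classic in h1; set J1 := `[_, _]%classic in h1.
set I2 := `[a2, _]%classic in h2; set J2 := `[_, _]%classic in h2.
set F := net_average _ _ _ _.
have bI (A : set R) : measurable A -> bounded_measurable (\1_A : R -> R).
  exact: bounded_measurable_indic.
have mI1 : measurable I1 by exact: measurable_itv.
have mJ1 : measurable J1 by exact: measurable_itv.
have mI2 : measurable I2 by exact: measurable_itv.
have mJ2 : measurable J2 by exact: measurable_itv.
have r1 := expr_half_gt0 k1.+1 : 0 < 2^-1 ^+ k1.+1 :> R.
have r2 := expr_half_gt0 k2.+1 : 0 < 2^-1 ^+ k2.+1 :> R.
rewrite half1 in a11; rewrite half2 in a21.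
have sub01 (u v : R) : 0 <= u -> v <= 1 -> `[u, v]%classic `<=` `[0, 1]%classic.
  by move=> u0 v1 x; rewrite /= !in_itv/=; lra.
have sI1 : I1 `<=` `[0, 1] by apply: sub01; lra.
have sJ1 : J1 `<=` `[0, 1] by apply: sub01; rewrite ?half1; lra.
have sI2 : I2 `<=` `[0, 1] by apply: sub01; lra.
have sJ2 : J2 `<=` `[0, 1] by apply: sub01; rewrite ?half2; lra.
have lI1 : len I1 = 2^-1 ^+ k1.+1 by rewrite len_segment; lra.
have lJ1 : len J1 = 2^-1 ^+ k1.+1 by rewrite len_segment half1; lra.
have lI2 : len I2 = 2^-1 ^+ k2.+1 by rewrite len_segment; lra.
have lJ2 : len J2 = 2^-1 ^+ k2.+1 by rewrite len_segment half2; lra.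
have gI1 : is_segment I1 by do 2 eexists; split; last reflexivity; lra.
have gJ1 : is_segment J1 by do 2 eexists; split; last reflexivity; rewrite half1; lra.
have gI2 : is_segment I2 by do 2 eexists; split; last reflexivity; lra.
have gJ2 : is_segment J2 by do 2 eexists; split; last reflexivity; rewrite half2; lra.
have bound (A B : set R) : measurable A -> measurable B ->
    A `<=` `[0, 1] -> B `<=` `[0, 1] -> is_segment A -> is_segment B ->
    len A = 2^-1 ^+ k1.+1 -> len B = 2^-1 ^+ k2.+1 ->
    (`|bil f \1_A \1_B|%:E <= (2^-1 ^+ k1.+1 * 2^-1 ^+ k2.+1)%:E * F)%E.
  move=> mA mB sA sB gA gB lA lB; rewrite bil_indic// -{1}lA -{1}lB.
  by apply: (@integral_le_net_average f (A, B)); rewrite /= ?lA ?lB.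
have -> : haar_coef f k1 k2 j1 j2 = bil f (haar k1 j1) (haar k2 j2) by [].
rewrite (@eq_bil_countable _ _ _ _ (fun x => d1 * \1_I1 x + e1 * \1_J1 x)
   _ (fun x => d2 * \1_I2 x + e2 * \1_J2 x) hf countable_dyadic)//; last 4 first.
- exact: bounded_measurable_haar.
- by apply: bounded_measurableD; apply: bounded_measurableZ; exact: bI.
- exact: bounded_measurable_haar.
- by apply: bounded_measurableD; apply: bounded_measurableZ; exact: bI.
have bZ (c : R) A : measurable A -> bounded_measurable (fun x : R => c * \1_A x).
  by move=> mA; apply: bounded_measurableZ; exact: bI.
rewrite bilDl ?bilDr ?bilZl ?bilZr; do ?[exact: bI|exact: bZ|exact: hf|
  by apply: bounded_measurableD; exact: bZ].
have [|Fy] := eqVneq F +oo%E; first by move=> ->; rewrite leey.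
have Ff : F \is a fin_num by rewrite ge0_fin_numE ?net_average_ge0// ltey.
move: bound; rewrite -(fineK Ff) => bound.
have b1 := bound I1 I2 mI1 mI2 sI1 sI2 gI1 gI2 lI1 lI2.
have b2 := bound I1 J2 mI1 mJ2 sI1 sJ2 gI1 gJ2 lI1 lJ2.
have b3 := bound J1 I2 mJ1 mI2 sJ1 sI2 gJ1 gI2 lJ1 lI2.
have b4 := bound J1 J2 mJ1 mJ2 sJ1 sJ2 gJ1 gJ2 lJ1 lJ2.
rewrite -!EFinM !lee_fin in b1 b2 b3 b4 *.
set s1 := 2 `^ (k1%:R / 2) in nd1 ne1 *.
set s2 := 2 `^ (k2%:R / 2) in nd2 ne2 *.
have s10 : 0 <= s1 by exact: powR_ge0.
have s20 : 0 <= s2 by exact: powR_ge0.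
set G := 2^-1 ^+ k1.+1 * 2^-1 ^+ k2.+1 * fine F in b1 b2 b3 b4.
have T (c d z : R) : `|c| = s1 -> `|d| = s2 -> `|z| <= G ->
   `|c * (d * z)| <= s1 * s2 * G.
  by move=> cE dE zG; rewrite !normrM cE dE mulrA ler_wpM2l// mulr_ge0.
apply: (@le_trans _ _ (s1 * s2 * (4 * (s1 * s2 * G)))).
  apply: ler_wpM2l; first exact: mulr_ge0.
  apply: le_trans (ler_normD _ _) _.
  have := T _ _ _ nd1 nd2 b1; have := T _ _ _ nd1 ne2 b2.
  have := T _ _ _ ne1 nd2 b3; have := T _ _ _ ne1 ne2 b4.
  have := ler_normD (d1 * (d2 * bil f \1_I1 \1_I2)) (d1 * (e2 * bil f \1_I1 \1_J2)).
  have := ler_normD (e1 * (d2 * bil f \1_J1 \1_I2)) (e1 * (e2 * bil f \1_J1 \1_J2)).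
  clear; lra.
rewrite le_eqVlt; apply/orP; left; apply/eqP.
have E1 : s1 * s1 * 2^-1 ^+ k1.+1 = 2^-1.
  by rewrite haar_height_sqr exprVn exprS invfM mulrCA divff ?mulr1// gt_eqF// exprn_gt0.
have E2 : s2 * s2 * 2^-1 ^+ k2.+1 = 2^-1.
  by rewrite haar_height_sqr exprVn exprS invfM mulrCA divff ?mulr1// gt_eqF// exprn_gt0.
transitivity (4 * (s1 * s1 * 2^-1 ^+ k1.+1) * (s2 * s2 * 2^-1 ^+ k2.+1) * fine F).
  by rewrite /G; clear; lra.
by rewrite E1 E2; clear; lra.
Qed.

End haar_functions.

(** * Haar expansion of the indicator of an interval *)

Section clamp_tent.
Context {R : realType}.
Implicit Types (y z : R).

(** The share of [0, 1] lying to the left of [y]. *)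
Definition clamp y : R := Num.max 0 (Num.min y 1).
(** The primitive of the Haar function equal to 1 on (0, 1/2) and to -1 on (1/2, 1). *)
Definition tent y : R := Num.max 0 (Num.min y (1 - y)).

Ltac case_clamp := rewrite /clamp /tent ?minEle ?maxEle;
  repeat match goal with
  | |- context [if (?a <= ?b)%O then _ else _] =>
    lazymatch b with context [if _ then _ else _] => fail | _ => idtac end;
    case: (leP a b) => ?
  end; lra.

Lemma clamp_ge0_le1 y : 0 <= clamp y <= 1.
Proof. case_clamp. Qed.

Lemma clamp_eq0 y : y <= 0 -> clamp y = 0.
Proof. move=> y0; case_clamp. Qed.

Lemma clamp_eq1 y : 1 <= y -> clamp y = 1.
Proof. move=> y0; case_clamp. Qed.

Lemma clamp_id y : 0 <= y <= 1 -> clamp y = y.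
Proof. move=> y0; case_clamp. Qed.

Lemma tent_ge0_le1 y : 0 <= tent y <= 1.
Proof. case_clamp. Qed.

Lemma tent_eq0 y : (y <= 0) || (1 <= y) -> tent y = 0.
Proof.
by move=> /orP[] y0; case_clamp.
Qed.

(** If [y] is the coordinate of a point relative to a dyadic interval, then [2 * y] and [2 * y - 1]
    are its coordinates relative to the two halves. The tent is thus the Haar correction refining
    the share: added on the left half, subtracted on the right one. *)
Lemma clamp_double y : clamp (2 * y) = clamp y + tent y.
Proof. case_clamp. Qed.

Lemma clamp_doubleB1 y : clamp (2 * y - 1) = clamp y - tent y.
Proof. case_clamp. Qed.

Lemma le_clamp y z : y <= z -> clamp y <= clamp z.
Proof. move=> yz; case_clamp. Qed.

(** By the doubling identities, both clamp + tent and clamp - tent are nondecreasing. *)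
Lemma tent_clamp_le y z : y <= z -> `|tent z - tent y| <= clamp z - clamp y.
Proof.
move=> yz; have h1 : clamp (2 * y) <= clamp (2 * z) by apply: le_clamp; lra.
have h2 : clamp (2 * y - 1) <= clamp (2 * z - 1) by apply: le_clamp; lra.
move: h1 h2; rewrite !clamp_double !clamp_doubleB1 ler_norml; lra.
Qed.

(** The cells [i, i + 1] tile [0, m], and the summands are their shares to the left of [y]. *)
Lemma sum_clamp (m : nat) y : 0 <= y <= m%:R -> \sum_(i < m) clamp (y - i%:R) = y.
Proof.
elim: m y => [|m IH] y /andP[y0 ym].
  by rewrite big_ord0; apply/eqP; rewrite eq_le y0.
rewrite big_ord_recr/=; have [ym'|ym'] := leP y m%:R.
  by rewrite IH ?y0// clamp_eq0 ?addr0 ?subr_le0.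
rewrite (eq_bigr (fun=> 1)) => [|i _]; last first.
  rewrite clamp_eq1// lerBrDr; have : (i : nat).+1%:R <= m%:R :> R.
    by rewrite ler_nat.
  by rewrite -natr1; lra.
rewrite sumr_const card_ord clamp_id; first by lra.
by move: ym; rewrite -natr1; lra.
Qed.

(** The tents have disjoint open supports, so at most one summand is nonzero. *)
Lemma sum_tent (m : nat) y : \sum_(i < m) tent (y - i%:R) <= 1.
Proof.
elim: m => [|m IH]; first by rewrite big_ord0.
rewrite big_ord_recr/=; have [ym|ym] := leP y m%:R.
  by rewrite tent_eq0 ?addr0// subr_le0 ym.
rewrite big1 ?add0r => [|i _]; first by have /andP[] := tent_ge0_le1 (y - m%:R).
rewrite tent_eq0//; apply/orP; right.
have : (i : nat).+1%:R <= m%:R :> R by rewrite ler_nat.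
by rewrite -natr1; lra.
Qed.

End clamp_tent.

Section indicator_expansion.
Context {R : realType}.
Implicit Types (a b x y : R).

(* The integral of haar k j over [0, b]; the unused pairs (k, 0) with k > 0
   get 0. *)
Definition step_coef (k j : nat) b : R :=
  if j == 0%N then (if k == 0%N then b else 0)
  else (2 `^ (k%:R / 2))^-1 * tent (2 ^+ k * b - j.-1%:R).

Definition step_partial_sum (N : nat) b x : R :=
  \sum_(k < N) \sum_(j < (2 ^ k).+1) step_coef k j b * haar k j x.

(** For [x] in [0, 1), the position, counted from 0, of the level-k dyadic interval containing
    it. *)
Definition dyadic_index (k : nat) x : nat := Num.truncn (2 ^+ k * x).

Lemma truncn_dyadic (k : nat) x : 0 <= x <= 1 -> ~ dyadic x ->
  (dyadic_index k x)%:R < 2 ^+ k * x < (dyadic_index k x).+1%:R.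
Proof.
move=> /andP[x0 x1] xD.
have p : 0 < 2 ^+ k :> R by rewrite exprn_gt0.
have := truncn_itv (mulr_ge0 (ltW p) x0); rewrite -/(dyadic_index k x) => /andP[].
rewrite le_eqVlt => /orP[/eqP h _|-> ->//].
exfalso; apply: xD; exists k, (dyadic_index k x).
by rewrite h mulrAC divff ?mul1r// gt_eqF.
Qed.

Lemma truncn_dyadic_lt (k : nat) x : 0 <= x <= 1 -> ~ dyadic x ->
  (dyadic_index k x < 2 ^ k)%N.
Proof.
move=> x01 xD; have /andP[h _] := truncn_dyadic k x01 xD.
have p : 0 < 2 ^+ k :> R by rewrite exprn_gt0.
rewrite -(ltr_nat R) natrX; apply: lt_le_trans h _.
by rewrite ger_pMr//; case/andP: x01.
Qed.

Lemma truncn_dyadicS (k : nat) x : 0 <= x <= 1 -> ~ dyadic x ->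
  dyadic_index k.+1 x = (dyadic_index k x).*2 \/ dyadic_index k.+1 x = (dyadic_index k x).*2.+1.
Proof.
move=> x01 xD; have /andP[h1 h2] := truncn_dyadic k x01 xD.
have /andP[g1 g2] := truncn_dyadic k.+1 x01 xD.
rewrite exprS -mulrA in g1 g2.
have A : (2 * dyadic_index k x < (dyadic_index k.+1 x).+1)%N.
  by rewrite -(ltr_nat R) natrM; lra.
have B : (dyadic_index k.+1 x < 2 * (dyadic_index k x).+1)%N.
  by rewrite -(ltr_nat R) natrM; lra.
lia.
Qed.

(** At a nondyadic point a single nonconstant Haar function of each level is nonzero. Its sign tells
    the half in which the point lies, that is, the parity of the next index. Haar indices start at 1
    and [dyadic_index] at 0, hence [j.+1]. *)
Lemma haar_truncn (k j : nat) x : 0 <= x <= 1 -> ~ dyadic x ->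
  haar k j.+1 x = 2 `^ (k%:R / 2) *
    (if j == dyadic_index k x then if dyadic_index k.+1 x == (dyadic_index k x).*2 then 1 else -1 else 0).
Proof.
move=> x01 xD; have /andP[h1 h2] := truncn_dyadic k x01 xD.
have /andP[g1 g2] := truncn_dyadic k.+1 x01 xD.
rewrite haarE//; congr (_ * _).
have p : 0 < 2 ^+ k.+1 :> R by rewrite exprn_gt0.
have E (u v : R) : (x \in `]u / 2 ^+ k.+1, v / 2 ^+ k.+1[%classic) =
    (u < 2 ^+ k.+1 * x < v).
  apply/idP/idP => [/set_mem|h]; last apply/mem_set; rewrite /= ?in_itv/=.
    by rewrite ltr_pdivrMr// ltr_pdivlMr// mulrC.
  by rewrite ltr_pdivrMr// ltr_pdivlMr// mulrC.
rewrite !indicE !E; set X := 2 ^+ k.+1 * x in g1 g2 *.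
have XE : X = 2 * (2 ^+ k * x) by rewrite /X exprS mulrA.
have jE : (2 * j.+1)%:R = 2 * j%:R + 2 :> R by rewrite natrM -natr1; lra.
rewrite !jE; rewrite -(natr1 (dyadic_index k x)) in h2.
rewrite -(natr1 (dyadic_index k.+1 x)) in g2.
case: (ltngtP j (dyadic_index k x)) => [jt|jt|->].
- have : j.+1%:R <= (dyadic_index k x)%:R :> R by rewrite ler_nat.
  rewrite -natr1 => jt'.
  have -> : 2 * j%:R + 2 - 2 < X < 2 * j%:R + 2 - 1 = false by apply/negP; lra.
  have -> : 2 * j%:R + 2 - 1 < X < 2 * j%:R + 2 = false by apply/negP; lra.
  by rewrite subr0.
- have : (dyadic_index k x).+1%:R <= j%:R :> R by rewrite ler_nat.
  rewrite -natr1 => jt'.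
  have -> : 2 * j%:R + 2 - 2 < X < 2 * j%:R + 2 - 1 = false by apply/negP; lra.
  have -> : 2 * j%:R + 2 - 1 < X < 2 * j%:R + 2 = false by apply/negP; lra.
  by rewrite subr0.
- have [tE|tE] := truncn_dyadicS k x01 xD.
  + rewrite tE eqxx; rewrite tE -muln2 natrM in g1 g2.
    have -> : 2 * (dyadic_index k x)%:R + 2 - 2 < X < 2 * (dyadic_index k x)%:R + 2 - 1 by lra.
    have -> : 2 * (dyadic_index k x)%:R + 2 - 1 < X < 2 * (dyadic_index k x)%:R + 2 = false.
      by apply/negP; lra.
    by rewrite subr0.
  + rewrite tE gtn_eqF//; rewrite tE -natr1 -muln2 natrM in g1 g2.
    have -> : 2 * (dyadic_index k x)%:R + 2 - 1 < X < 2 * (dyadic_index k x)%:R + 2 by lra.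
    have -> : 2 * (dyadic_index k x)%:R + 2 - 2 < X < 2 * (dyadic_index k x)%:R + 2 - 1 = false.
      by apply/negP; lra.
    by rewrite sub0r.
Qed.

Lemma step_level_sum (k : nat) b x : 0 <= x <= 1 -> ~ dyadic x ->
  \sum_(j < (2 ^ k).+1) step_coef k j b * haar k j x =
  (if k == 0%N then b else 0) +
  (if dyadic_index k.+1 x == (dyadic_index k x).*2 then 1 else -1) * tent (2 ^+ k * b - (dyadic_index k x)%:R).
Proof.
move=> x01 xD; rewrite big_ord_recl/= haar0 mulr1; congr (_ + _).
have lt := truncn_dyadic_lt k x01 xD.
rewrite (bigD1 (Ordinal lt))//= big1 ?addr0; last first.
  move=> i; rewrite -val_eqE/= => ni.
  by rewrite haar_truncn// (negPf ni) !mulr0.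
rewrite haar_truncn// eqxx /step_coef/= mulrAC mulrA mulVf ?mul1r//.
Qed.

(** The partial sum is the average of the indicator of [0, b] over the dyadic interval of level N +
    1 containing [x], i.e. the share of that interval to the left of [b]. The doubling identities
    carry it from level to level. *)
Lemma step_partial_sumE (N : nat) b x : 0 <= b <= 1 -> 0 <= x <= 1 -> ~ dyadic x ->
  step_partial_sum N.+1 b x = clamp (2 ^+ N.+1 * b - (dyadic_index N.+1 x)%:R).
Proof.
move=> b01 x01 xD.
(* At n = 0 the empty sum lacks the constant Haar term, whose coefficient is [b]; supplying it lets
   the induction start. *)
suff H n : (if n == 0%N then b else 0) + step_partial_sum n b x =
    clamp (2 ^+ n * b - (dyadic_index n x)%:R) by rewrite -H add0r.
elim: n => [|n IH].
  rewrite /step_partial_sum big_ord0 addr0 expr0 mul1r.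
  have := truncn_dyadic_lt 0 x01 xD; rewrite expn0 ltnS leqn0 => /eqP ->.
  by rewrite subr0 clamp_id.
rewrite /= add0r /step_partial_sum big_ord_recr/= step_level_sum//.
rewrite addrA (addrC _ (if _ then _ else _)) IH.
set y := 2 ^+ n * b - _.
have [tE|tE] := truncn_dyadicS n x01 xD; rewrite tE.
  by rewrite eqxx mul1r -clamp_double /y exprS -muln2 natrM; congr clamp; lra.
rewrite gtn_eqF// mulN1r -clamp_doubleB1 /y exprS -(natr1 (dyadic_index n x).*2) -muln2 natrM.
by congr clamp; lra.
Qed.

(** Once 2^-N is below the distance from [x] to [b], the dyadic interval containing [x] no longer
    contains [b], and its share is exactly 0 or 1. *)
Lemma step_partial_sum_near (b x : R) : 0 <= b <= 1 -> 0 <= x <= 1 ->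
  ~ dyadic x -> x != b ->
  \forall N \near \oo, step_partial_sum N b x = (x < b)%R%:R.
Proof.
move=> b01 x01 xD xb.
have e0 : 0 < `|b - x| by rewrite normr_gt0 subr_eq0 eq_sym.
have [m hm] := expr_half_arch e0.
exists m.+1 => // -[//|N] /= mN; rewrite step_partial_sumE//.
have /andP[g1 g2] := truncn_dyadic N.+1 x01 xD.
have p : 0 < 2 ^+ N.+1 :> R by rewrite exprn_gt0.
have : 1 < 2 ^+ N.+1 * `|b - x|.
  rewrite -ltr_pdivrMl// mulr1 -exprVn; apply: le_lt_trans hm.
  by apply: expr_half_le; lia.
rewrite -natr1 in g2; have [xltb|bltx] := ltP x b.
  by rewrite gtr0_norm ?subr_gt0// mulrBr => h; rewrite clamp_eq1//; lra.
rewrite ler0_norm ?subr_le0// opprB mulrBr => h; rewrite clamp_eq0//; lra.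
Qed.

Lemma step_coef_level0 (k j : nat) b : ~ haar_level_full k j ->
  (j < (2 ^ k).+1)%N -> step_coef k j b = 0.
Proof.
move=> nkj jk; rewrite /step_coef; case: eqP => [j0|/eqP j0].
  by case: eqP => // k0; exfalso; apply: nkj; right.
by exfalso; apply: nkj; left; rewrite /haar_level/= lt0n j0.
Qed.

(** Two bounds on the differences of tents compete: comparison with [clamp] gives 2^k (b - a), and
    disjointness of supports gives 1 per endpoint, so 2 in all. The first serves for k <= n, the
    second for k > n; the truncated [k - n] covers both. At level 0 the constant function adds b -
    a. *)
Lemma step_coef_l1 (k n : nat) a b : 0 <= a -> a < b -> b <= 1 ->
  2^-1 ^+ n <= b - a ->
  \sum_(j < (2 ^ k).+1) `|step_coef k j b - step_coef k j a| <=
  3 * (b - a) * 2 `^ (k%:R / 2) * 2^-1 ^+ (k - n).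
Proof.
move=> a0 ab b1 nab; rewrite big_ord_recl.
set s := 2 `^ (k%:R / 2).
have s1 : 1 <= s by exact: haar_height_ge1.
have s0 : 0 < s by exact: lt_le_trans s1.
have ss : s * s = 2 ^+ k by exact: haar_height_sqr.
have p : 0 < 2 ^+ k :> R by rewrite exprn_gt0.
have t1 : \sum_(j < 2 ^ k) `|step_coef k (lift ord0 j) b - step_coef k (lift ord0 j) a|
    = s^-1 * \sum_(j < 2 ^ k) `|tent (2 ^+ k * b - j%:R) - tent (2 ^+ k * a - j%:R)|.
  rewrite mulr_sumr; apply: eq_bigr => j _; rewrite /step_coef/= -mulrBr normrM.
  by rewrite [`|_^-1|]gtr0_norm// invr_gt0.
rewrite {}t1; set T := \sum_(j < _) _.
have T1 : T <= 2 ^+ k * (b - a).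
  apply: (@le_trans _ _ (\sum_(j < 2 ^ k)
     (clamp (2 ^+ k * b - j%:R) - clamp (2 ^+ k * a - j%:R)))).
    apply: ler_sum => j _; apply: tent_clamp_le.
    by rewrite lerD2r ler_pM2l// ltW.
  have in01 z : 0 <= z <= 1 -> 0 <= 2 ^+ k * z <= (2 ^ k)%:R.
    by move=> /andP[z0 z1]; rewrite natrX mulr_ge0 ?(ltW p)//= ger_pMr.
  rewrite sumrB !sum_clamp ?mulrBr//; apply: in01; lra.
have T2 : T <= 2.
  apply: (@le_trans _ _ (\sum_(j < 2 ^ k)
     (tent (2 ^+ k * b - j%:R) + tent (2 ^+ k * a - j%:R)))).
    apply: ler_sum => j _; apply: le_trans (ler_normB _ _) _.
    have t0 (z : R) : 0 <= tent z by case/andP: (tent_ge0_le1 z).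
    by rewrite !ger0_norm.
  rewrite big_split/=; have := sum_tent (2 ^ k) (2 ^+ k * b : R).
  have := sum_tent (2 ^ k) (2 ^+ k * a : R); lra.
have sV : s^-1 * 2 ^+ k = s by rewrite -ss mulrA mulVf ?mul1r// gt_eqF.
have T1' : s^-1 * T <= s * (b - a).
  rewrite -{2}sV -mulrA ler_pM2l// invr_gt0//.
have ba : 0 < b - a by rewrite subr_gt0.
have c0 : `|step_coef k (@ord0 (2 ^ k)) b - step_coef k (@ord0 (2 ^ k)) a| =
    if k == 0%N then b - a else 0.
  rewrite /step_coef/=; case: ifP => _; last by rewrite subrr normr0.
  by rewrite gtr0_norm.
rewrite {}c0.
have bas : b - a <= s * (b - a) by rewrite ler_peMl// ltW.
have [kn|nk] := leqP k n.
  move: kn; rewrite -subn_eq0 => /eqP ->; rewrite expr0 mulr1.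
  by case: ifP => _; lra.
rewrite gtn_eqF ?(leq_ltn_trans _ nk)// add0r.
have h : 1 <= 2 ^+ n * (b - a).
  by rewrite -ler_pdivrMl ?exprn_gt0// mulr1 -exprVn.
(* Since s^2 = 2^k, the bound 2/s equals 2 s 2^(n-k) 2^-n, and 2^-n is at most b - a. *)
have E : s^-1 = s * 2^-1 ^+ (k - n) * 2^-1 ^+ n.
  by rewrite -mulrA -exprD subnK 1?ltnW// exprVn -ss invfM mulrA divff ?mul1r// gt_eqF.
have E2 : 2^-1 ^+ n <= b - a by [].
apply: (@le_trans _ _ (s^-1 * 2)); first by rewrite ler_pM2l// invr_gt0.
rewrite E.
have z0 : 0 < s * 2^-1 ^+ (k - n) by rewrite mulr_gt0// expr_half_gt0.
have : s * 2^-1 ^+ (k - n) * 2^-1 ^+ n <= s * 2^-1 ^+ (k - n) * (b - a).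
  by rewrite ler_pM2l.
have : 0 <= s * 2^-1 ^+ (k - n) * (b - a) by rewrite mulr_ge0// ltW.
lra.
Qed.

End indicator_expansion.

(** * Integrals over rectangles *)

Lemma countable_setU {T : Type} (A B : set T) :
  countable A -> countable B -> countable (A `|` B).
Proof.
move=> cA cB; rewrite (_ : A `|` B = \bigcup_(b in [set: bool]) if b then A else B).
  by apply: bigcup_countable => [|[]]//; exact: countableP.
apply/seteqP; split => x; first by case => ?; [exists true|exists false].
by case => -[] _ ?; [left|right].
Qed.

Section upper_bound.
Context {R : realType}.
Implicit Types (f : R * R -> R) (a b x y : R).

(** Off the null cross over [D] both factors are bounded by 1, so [|f|] dominates the integrands. *)
Lemma bil_cvg f (u_ v_ : nat -> R -> R) (u v : R -> R) (D : set R) :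
  L1_unit_square f -> countable D ->
  (forall n, bounded_measurable (u_ n)) -> (forall n, bounded_measurable (v_ n)) ->
  bounded_measurable u -> bounded_measurable v ->
  (forall n x, 0 <= x <= 1 -> ~ D x -> `|u_ n x| <= 1) ->
  (forall n x, 0 <= x <= 1 -> ~ D x -> `|v_ n x| <= 1) ->
  (forall x, 0 <= x <= 1 -> ~ D x -> \forall n \near \oo, u_ n x = u x) ->
  (forall x, 0 <= x <= 1 -> ~ D x -> \forall n \near \oo, v_ n x = v x) ->
  bil f (u_ n) (v_ n) @[n --> \oo] --> bil f u v.
Proof.
move=> hf cD bu_ bv_ bu bv u1 v1 uu vv.
have neg := lebesgue2_negligible_cross cD.
have [] := @dominated_convergence _ _ R (lebesgue2 R) (`[0, 1] `*` `[0, 1])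
   measurable_sq (fun n => EFin \o (fun x : R * R => f x * u_ n x.1 * v_ n x.2))
   (EFin \o (fun x : R * R => f x * u x.1 * v x.2)) (fun x : R * R => `|f x|%:E).
- by move=> n; exact: measurable_int (integrable_bil hf (bu_ n) (bv_ n)).
- exact: measurable_int (integrable_bil hf bu bv).
- apply: negligibleS neg => x /= nx.
  apply: contrapT => /not_orP[D1 D2]; apply: nx => -[/= x1 x2].
  apply: cvg_near_cst.
  rewrite !in_itv/= in x1 x2.
  apply: filterS2 (uu _ x1 D1) (vv _ x2 D2) => n -> -> //.
- exact: integrable_norm hf.
- apply: negligibleS neg => x /= nx.
  apply: contrapT => /not_orP[D1 D2]; apply: nx => n -[/= x1 x2].
  rewrite !in_itv/= in x1 x2.
  rewrite lee_fin -mulrA normrM ler_piMr// normrM.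
  by rewrite mulr_ile1// ?u1 ?v1.
move=> _ _ cv.
apply: fine_cvg; rewrite /bil fineK//.
by apply: integrable_fin_num; [exact: measurable_sq|exact: integrable_bil].
Qed.

Definition haar_sum (N : nat) (d : nat -> nat -> R) x : R :=
  \sum_(k < N) \sum_(j < (2 ^ k).+1) d k j * haar k j x.

Lemma bil_haar_sum f N1 N2 (d1 d2 : nat -> nat -> R) : L1_unit_square f ->
  bil f (haar_sum N1 d1) (haar_sum N2 d2) =
  \sum_(k1 < N1) \sum_(j1 < (2 ^ k1).+1) \sum_(k2 < N2) \sum_(j2 < (2 ^ k2).+1)
    d1 k1 j1 * (d2 k2 j2 * haar_coef f k1 k2 j1 j2).
Proof.
move=> hf.
have bh k j : bounded_measurable (haar k j : R -> R) := bounded_measurable_haar k j.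
have bl (d : nat -> nat -> R) (k : nat) :
    bounded_measurable (fun x => \sum_(j < (2 ^ k).+1) d k j * haar k j x).
  by apply: bounded_measurable_sum => j _; exact: bounded_measurableZ.
have bs (d : nat -> nat -> R) N : bounded_measurable (haar_sum N d).
  by apply: bounded_measurable_sum => k _; exact: bl.
(* The factor 1 gives the outer sum the shape of a linear combination expected by [bil_suml] and
   [bil_sumr]. *)
have sumE (d : nat -> nat -> R) N : haar_sum N d =
    fun x => \sum_(k < N) 1 * (\sum_(j < (2 ^ k).+1) d k j * haar k j x).
  by apply/funext => x; apply: eq_bigr => k _; rewrite mul1r.
rewrite [haar_sum N1 d1]sumE.
etransitivity; first exact: (bil_suml _ _ hf (fun k : 'I_N1 => bl d1 k) (bs d2 N2)).
apply: eq_bigr => k1 _; rewrite mul1r.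
etransitivity.
  exact: (bil_suml _ _ hf (fun j : 'I_(2 ^ k1).+1 => bh k1 j) (bs d2 N2)).
apply: eq_bigr => j1 _; rewrite [haar_sum N2 d2]sumE.
under [RHS]eq_bigr do rewrite -mulr_sumr.
rewrite -mulr_sumr; congr (_ * _).
etransitivity.
  exact: (bil_sumr _ _ hf (bh k1 j1) (fun k : 'I_N2 => bl d2 k)).
apply: eq_bigr => k2 _; rewrite mul1r.
exact: (bil_sumr _ _ hf (bh k1 j1) (fun j : 'I_(2 ^ k2).+1 => bh k2 j)).
Qed.

Lemma bil_haar_sum_le f N1 N2 (d1 d2 : nat -> nat -> R) (A : nat -> nat -> R) :
  L1_unit_square f ->
  (forall k j, (j < (2 ^ k).+1)%N -> ~ haar_level_full k j -> d1 k j = 0) ->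
  (forall k j, (j < (2 ^ k).+1)%N -> ~ haar_level_full k j -> d2 k j = 0) ->
  (forall k1 k2 j1 j2, haar_level_full k1 j1 -> haar_level_full k2 j2 ->
     `|haar_coef f k1 k2 j1 j2| <= A k1 k2) ->
  `|bil f (haar_sum N1 d1) (haar_sum N2 d2)| <=
  \sum_(k1 < N1) \sum_(k2 < N2)
    (\sum_(j < (2 ^ k1).+1) `|d1 k1 j|) * (\sum_(j < (2 ^ k2).+1) `|d2 k2 j|) *
    A k1 k2.
Proof.
move=> hf d10 d20 hA; rewrite bil_haar_sum//.
apply: le_trans (ler_norm_sum _ _ _) _; apply: ler_sum => k1 _.
rewrite exchange_big/=.
apply: le_trans (ler_norm_sum _ _ _) _; apply: ler_sum => k2 _.
apply: le_trans (ler_norm_sum _ _ _) _.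
rewrite mulr_suml mulr_suml; apply: ler_sum => j1 _.
apply: le_trans (ler_norm_sum _ _ _) _.
rewrite mulr_sumr mulr_suml; apply: ler_sum => j2 _.
rewrite !normrM mulrA.
have [l1|l1] := pselect (haar_level_full k1 j1); last first.
  by rewrite d10// normr0 !mul0r.
have [l2|l2] := pselect (haar_level_full k2 j2); last first.
  by rewrite d20// normr0 !(mulr0, mul0r).
by apply: ler_wpM2l; rewrite ?mulr_ge0//; exact: hA.
Qed.

(** The constant 9 is 3 times 3, one factor for each side from [step_coef_l1]. The bound [E] is
    uniform in the length of the partial sums, so it survives the limit. *)
Lemma integral_rectangle_le f (a1 b1 a2 b2 : R) (n1 n2 : nat)
    (A : nat -> nat -> R) (E : R) :
  L1_unit_square f ->
  (forall k1 k2 j1 j2, haar_level_full k1 j1 -> haar_level_full k2 j2 ->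
     `|haar_coef f k1 k2 j1 j2| <= A k1 k2) ->
  (forall N : nat, \sum_(k1 < N) \sum_(k2 < N)
     (2 `^ (k1%:R / 2) * 2^-1 ^+ (k1 - n1)) *
     (2 `^ (k2%:R / 2) * 2^-1 ^+ (k2 - n2)) * A k1 k2 <= E) ->
  0 <= a1 -> a1 < b1 -> b1 <= 1 -> 2^-1 ^+ n1 <= b1 - a1 ->
  0 <= a2 -> a2 < b2 -> b2 <= 1 -> 2^-1 ^+ n2 <= b2 - a2 ->
  `|\int[lebesgue2 R]_(x in `[a1, b1] `*` `[a2, b2]) f x| <=
  (b1 - a1) * (b2 - a2) * (9 * E).
Proof.
move=> hf hA hE a10 ab1 b11 nb1 a20 ab2 b21 nb2.
have A0 k1 k2 : 0 <= A k1 k2.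
  apply: le_trans (hA k1 k2 1%N 1%N _ _) => //;
    by left; rewrite /haar_level/= expn_gt0.
(* Up to an endpoint, the indicator of [a, b] is the difference of those of [0, b] and [0, a]. *)
pose d a b k j : R := step_coef k j b - step_coef k j a.
have dE a b N : haar_sum N (d a b) =
    fun x => step_partial_sum N b x - step_partial_sum N a x.
  apply/funext => x; rewrite /haar_sum /step_partial_sum -sumrB.
  apply: eq_bigr => k _; rewrite -sumrB; apply: eq_bigr => j _.
  by rewrite /d mulrBl.
have bs a b N : bounded_measurable (haar_sum N (d a b)).
  apply: bounded_measurable_sum => k _; apply: bounded_measurable_sum => j _.
  by apply: bounded_measurableZ; exact: bounded_measurable_haar.
have d0 a b k j : (j < (2 ^ k).+1)%N -> ~ haar_level_full k j -> d a b k j = 0.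
  by move=> jk nkj; rewrite /d !step_coef_level0// subrr.
(* Both step sums lie in [0, 1], so their difference has absolute value at most 1. The shift to
   [N.+1] skips the empty sum, which the closed form does not cover. *)
have dle1 a b N x : 0 <= a -> a < b -> b <= 1 -> 0 <= x <= 1 -> ~ dyadic x ->
    `|haar_sum N.+1 (d a b) x| <= 1.
  move=> a0 ab hb x01 xD; rewrite dE !step_partial_sumE//; try lra.
  have /andP[? ?] := clamp_ge0_le1 (2 ^+ N.+1 * b - (dyadic_index N.+1 x)%:R).
  have /andP[? ?] := clamp_ge0_le1 (2 ^+ N.+1 * a - (dyadic_index N.+1 x)%:R).
  by rewrite ler_norml; lra.
have dcv a b x : 0 <= a -> a < b -> b <= 1 -> 0 <= x <= 1 -> ~ dyadic x ->
    x != a -> x != b ->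
    \forall N \near \oo, haar_sum N.+1 (d a b) x = \1_(`[a, b]%classic) x.
  move=> a0 ab hb x01 xD xa xb.
  have a01 : 0 <= a <= 1 by lra.
  have b01 : 0 <= b <= 1 by lra.
  have [N1 _ h1] := step_partial_sum_near a01 x01 xD xa.
  have [N2 _ h2] := step_partial_sum_near b01 x01 xD xb.
  exists (maxn N1 N2) => // N hN; rewrite [LHS]/= dE.
  have hN1 : (N1 <= N.+1)%N by apply: leqW; exact: leq_trans (leq_maxl _ _) hN.
  have hN2 : (N2 <= N.+1)%N by apply: leqW; exact: leq_trans (leq_maxr _ _) hN.
  rewrite (h1 _ hN1) (h2 _ hN2).
  rewrite indicE; have [xltb|xgeb] := ltP x b; have [xlta|xgea] := ltP x a.
  - by rewrite subrr memNset// /= in_itv/=; lra.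
  - by rewrite subr0 mem_set// /= in_itv/=; lra.
  - by exfalso; lra.
  - by rewrite subrr memNset// /= in_itv/= => /andP[_ xb']; move: xb; rewrite eq_le xb' xgeb.
(* Convergence to the indicator is known only away from the endpoints, so these join the exceptional
   set. *)
pose D : set R := dyadic `|` [set a1; b1; a2; b2].
have cD : countable D.
  apply: countable_setU; first exact: countable_dyadic.
  exact: finite_set_countable.
have nD x c : ~ D x -> [set a1; b1; a2; b2] c -> x != c.
  by move=> nDx Dc; apply/eqP => xc; apply: nDx; right; rewrite xc.
have U1 n x : 0 <= x <= 1 -> ~ D x -> `|haar_sum n.+1 (d a1 b1) x| <= 1.
  by move=> x01 nDx; apply: dle1 => // xD; apply: nDx; left.
have V1 n x : 0 <= x <= 1 -> ~ D x -> `|haar_sum n.+1 (d a2 b2) x| <= 1.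
  by move=> x01 nDx; apply: dle1 => // xD; apply: nDx; left.
have Uc x : 0 <= x <= 1 -> ~ D x ->
    \forall N \near \oo, haar_sum N.+1 (d a1 b1) x = \1_(`[a1, b1]%classic) x.
  move=> x01 nDx; apply: dcv => //; first by move=> xD; apply: nDx; left.
  + by apply: nD nDx _; left; left; left.
  + by apply: nD nDx _; left; left; right.
have Vc x : 0 <= x <= 1 -> ~ D x ->
    \forall N \near \oo, haar_sum N.+1 (d a2 b2) x = \1_(`[a2, b2]%classic) x.
  move=> x01 nDx; apply: dcv => //; first by move=> xD; apply: nDx; left.
  + by apply: nD nDx _; left; right.
  + by apply: nD nDx _; right.
have := @bil_cvg f (fun N => haar_sum N.+1 (d a1 b1)) (fun N => haar_sum N.+1 (d a2 b2))
  (\1_(`[a1, b1]%classic)) (\1_(`[a2, b2]%classic)) D hf cD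
  (fun N => bs _ _ _) (fun N => bs _ _ _)
  (bounded_measurable_indic (measurable_itv _))
  (bounded_measurable_indic (measurable_itv _)).
have sub01 (u v : R) : 0 <= u -> v <= 1 -> `[u, v]%classic `<=` `[0, 1]%classic.
  by move=> u0 v1 x; rewrite /= !in_itv/=; lra.
rewrite bil_indic; [|exact: measurable_itv|exact: measurable_itv|exact: sub01|exact: sub01].
move=> cv.
have {}cv := cv U1 V1 Uc Vc.
move/cvg_norm : cv => cv.
rewrite -(cvg_lim (@Rhausdorff R) cv).
apply: limr_le; first exact: cvgP cv.
apply: nearW => N.
apply: le_trans (bil_haar_sum_le _ _ hf (d0 a1 b1) (d0 a2 b2) hA) _.
have ba1 : 0 < b1 - a1 by rewrite subr_gt0.
have ba2 : 0 < b2 - a2 by rewrite subr_gt0.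
apply: le_trans (ler_wpM2l _ (ler_wpM2l _ (hE N.+1))) => //; last first.
  by rewrite mulr_ge0// ltW.
rewrite !mulr_sumr; apply: ler_sum => k1 _.
rewrite !mulr_sumr; apply: ler_sum => k2 _.
have l1 := @step_coef_l1 R k1 n1 a1 b1 a10 ab1 b11 nb1.
have l2 := @step_coef_l1 R k2 n2 a2 b2 a20 ab2 b21 nb2.
have := ler_pM (sumr_ge0 _ _) (sumr_ge0 _ _) l1 l2.
move=> /(_ (fun i _ => normr_ge0 _) (fun i _ => normr_ge0 _)) l.
apply: le_trans (ler_wpM2r (A0 _ _) l) _.
rewrite le_eqVlt; apply/orP; left; apply/eqP; lra.
Qed.

End upper_bound.

(** * The net norm as a mixed sequence norm *)

Section mixed_lq_norm.
Context {R : realType}.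
Implicit Types (q : \bar R) (b x : nat -> nat -> \bar R).

Definition lq_norm2 (q1 q2 : \bar R) (b : nat -> nat -> \bar R) : \bar R :=
  lq_norm q2 (fun k2 => lq_norm q1 (fun k1 => b k1 k2)).

Lemma lq_norm2_ge0 q1 q2 b : (0 < q1)%E -> (0 < q2)%E ->
  (forall k1 k2, 0 <= b k1 k2)%E -> (0 <= lq_norm2 q1 q2 b)%E.
Proof. by move=> q10 q20 b0; apply: lq_norm_ge0 => // k; exact: lq_norm_ge0. Qed.

Lemma le_lq_norm2 q1 q2 b x : (0 < q1)%E -> (0 < q2)%E ->
  (forall k1 k2, 0 <= b k1 k2)%E -> (forall k1 k2, b k1 k2 <= x k1 k2)%E ->
  (lq_norm2 q1 q2 b <= lq_norm2 q1 q2 x)%E.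
Proof.
move=> q10 q20 b0 bx; apply: le_lq_norm => // k; first exact: lq_norm_ge0.
exact: le_lq_norm.
Qed.

Lemma lq_norm2Z q1 q2 (c : R) b : (0 < q1)%E -> (0 < q2)%E -> 0 <= c ->
  (forall k1 k2, 0 <= b k1 k2)%E ->
  (lq_norm2 q1 q2 (fun k1 k2 => c%:E * b k1 k2) = c%:E * lq_norm2 q1 q2 b)%E.
Proof.
move=> q10 q20 c0 b0; rewrite /lq_norm2 -lq_normZ//; last first.
  by move=> k; exact: lq_norm_ge0.
by congr lq_norm; apply/funext => k; rewrite lq_normZ.
Qed.

Lemma lq_norm2_shift q1 q2 b : (0 < q1)%E -> (0 < q2)%E ->
  (forall k1 k2, 0 <= b k1 k2)%E ->
  (lq_norm2 q1 q2 (fun k1 k2 => b k1.+1 k2.+1) <= lq_norm2 q1 q2 b)%E.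
Proof.
move=> q10 q20 b0.
apply: le_trans (lq_norm_shift (b := fun k2 => lq_norm q1 (b ^~ k2)) q20 _).
  apply: le_lq_norm => // k2; first exact: lq_norm_ge0.
  exact: (lq_norm_shift (b := b ^~ k2.+1)).
by move=> k; exact: lq_norm_ge0.
Qed.

(** The weight in k2 occurs twice on purpose. For fixed n2 one copy lets the supremum over k2 leave
    the inner norm. There remain a one-variable convolution in k1 and, with the other copy, one in
    k2. *)
Lemma lq_norm2_convolution_sup q1 q2 (eta : R) : (0 < q1)%E -> (0 < q2)%E ->
  0 < eta < 1 ->
  exists2 C : R, 0 < C & forall x, (forall k1 k2, 0 <= x k1 k2)%E ->
  (lq_norm2 q1 q2 (fun n1 n2 =>
     ereal_sup (range (fun k2 => (eta ^+ dist k2 n2)%:E *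
       ((eta ^+ dist k2 n2)%:E *
        ereal_sup (range (fun k1 => (eta ^+ dist k1 n1)%:E * x k1 k2))))))
   <= C%:E * lq_norm2 q1 q2 x)%E.
Proof.
move=> q10 q20 eta01; have /andP[eta0 _] := eta01.
have [CT CT0 hT] := lq_norm_weighted_sup q10 eta01.
have [C1 C10 h1] := lq_norm_convolution_sup q10 eta01.
have [C2 C20 h2] := lq_norm_convolution_sup q20 eta01.
exists (CT * (C1 * C2)); first by rewrite !mulr_gt0.
move=> x x0.
have w0 m n : 0 <= eta ^+ dist m n by rewrite exprn_ge0// ltW.
have sup0 (y : nat -> \bar R) : (forall k, 0 <= y k)%E -> (0 <= ereal_sup (range y))%E.
  by move=> y0; apply: le_ereal_sup_tmp; exists (y 0) => //; exists 0.
pose Y n1 k2 := ereal_sup (range (fun k1 => (eta ^+ dist k1 n1)%:E * x k1 k2)%E).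
have Y0 n1 k2 : (0 <= Y n1 k2)%E.
  by apply: (sup0 (fun k1 => (eta ^+ dist k1 n1)%:E * x k1 k2)%E) => k1;
    rewrite mule_ge0// lee_fin.
have X0 k2 : (0 <= lq_norm q1 (x ^~ k2))%E by exact: lq_norm_ge0.
apply: (@le_trans _ _ (lq_norm q2 (fun n2 => CT%:E * (C1%:E *
   ereal_sup (range (fun k2 => (eta ^+ dist k2 n2)%:E * lq_norm q1 (x ^~ k2)))))%E)).
  apply: le_lq_norm => // n2.
    apply: lq_norm_ge0 => // n1.
    apply: (sup0 (fun k2 => (eta ^+ dist k2 n2)%:E *
      ((eta ^+ dist k2 n2)%:E * Y n1 k2))%E) => k2.
    by rewrite !mule_ge0 ?lee_fin.
  apply: le_trans (hT n2 (fun n1 k2 => (eta ^+ dist k2 n2)%:E * Y n1 k2)%E _) _.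
    by move=> n m; rewrite mule_ge0// lee_fin.
  apply: lee_wpmul2l; first by rewrite lee_fin ltW.
  rewrite -ereal_supZ ?(ltW C10)//; last by move=> k; rewrite mule_ge0// lee_fin.
  apply/ereal_supP => _ [k2 _ <-]; rewrite lq_normZ//.
  apply: (@le_trans _ _ ((eta ^+ dist k2 n2)%:E * (C1%:E * lq_norm q1 (x ^~ k2)))%E).
    by apply: lee_wpmul2l; rewrite ?lee_fin//; exact: h1.
  by rewrite muleCA; apply: ereal_sup_ubound; exists k2.
rewrite lq_normZ ?(ltW CT0)//; last first.
  move=> k; rewrite mule_ge0 ?lee_fin ?(ltW C10)//.
  by apply: (sup0 (fun k2 => (eta ^+ dist k2 k)%:E * lq_norm q1 (x ^~ k2))%E)
    => m; rewrite mule_ge0 ?lee_fin.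
rewrite lq_normZ ?(ltW C10)//; last first.
  by move=> k; apply: (sup0 (fun k2 => (eta ^+ dist k2 k)%:E * lq_norm q1 (x ^~ k2))%E)
    => m; rewrite mule_ge0 ?lee_fin.
rewrite !EFinM -!muleA; apply: lee_wpmul2l; first by rewrite lee_fin ltW.
by apply: lee_wpmul2l; [rewrite lee_fin ltW|exact: h2].
Qed.

End mixed_lq_norm.

Lemma Lq_dt_over_t_norm_ge0 {R : realType} (q : \bar R) (phi : R -> \bar R) :
  (0 < q)%E -> (forall t, 0 < t -> (0 <= phi t)%E) ->
  (0 <= Lq_dt_over_t_norm q phi)%E.
Proof.
case: q => [r| |]//= q0 phi0; first exact: poweR_ge0.
apply: le_ereal_sup_tmp; exists (phi 1); last exact: phi0.
by exists 1 => //; rewrite /= in_itv/= ltr01.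
Qed.

Section discretization.
Context {R : realType}.
Variables (p1 p2 : R) (q1 q2 : \bar R).
Hypotheses (p11 : 1 < p1) (p21 : 1 < p2) (q10 : (0 < q1)%E) (q20 : (0 < q2)%E).

Definition net_sample (f : R * R -> R) (n1 n2 : nat) : \bar R :=
  (((2^-1 ^+ n1) `^ p1^-1 * (2^-1 ^+ n2) `^ p2^-1)%:E *
   net_average unit_square_rectangles f (2^-1 ^+ n1) (2^-1 ^+ n2))%E.

Lemma net_sample_ge0 f n1 n2 : (0 <= net_sample f n1 n2)%E.
Proof. by rewrite mule_ge0 ?net_average_ge0// lee_fin mulr_ge0 ?powR_ge0. Qed.

Lemma net_average_anti (f : R * R -> R) (t1 t2 u1 u2 : R) : t1 <= u1 -> t2 <= u2 ->
  (net_average unit_square_rectangles f u1 u2 <=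
   net_average unit_square_rectangles f t1 t2)%E.
Proof.
move=> tu1 tu2; apply: ereal_sup_le => z [->|[Q [MQ h1 h2] <-]]; first by left.
by right; exists Q => //; split => //; [exact: le_trans h1|exact: le_trans h2].
Qed.

Lemma len_le1 (I : set R) : is_segment I -> I `<=` `[0, 1] -> len I <= 1.
Proof.
move=> [a [b [ab ->]]] ab01; rewrite len_segment//.
have := ab01 a; rewrite /= !in_itv/= lexx (ltW ab) => /(_ isT)/andP[a0 _].
have := ab01 b; rewrite /= !in_itv/= lexx (ltW ab) => /(_ isT)/andP[_ b1].
lra.
Qed.

Lemma net_average_eq0 (f : R * R -> R) (t1 t2 : R) : (1 < t1) || (1 < t2) ->
  net_average unit_square_rectangles f t1 t2 = 0%E.
Proof.
move=> t12; apply/le_anti; rewrite net_average_ge0 andbT.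
apply/ereal_supP => y [->//|[Q [[s1 s2 Q1 Q2] h1 h2] _]]; exfalso.
have := len_le1 s1 Q1; have := len_le1 s2 Q2.
by case/orP: t12; lra.
Qed.

(** Halving t divides t^(1/p) by 2^(1/p), which is at most 2 since p > 1. *)
Lemma powR_expr_halfS (p : R) n : 1 < p ->
  (2^-1 ^+ n) `^ p^-1 <= 2 * (2^-1 ^+ n.+1) `^ p^-1.
Proof.
move=> hp; have pV : 0 <= p^-1 <= 1 by rewrite invr_ge0 invf_le1; lra.
have /andP[pV0 pV1] := pV.
rewrite [X in _ <= _ * X](_ : _ = (2^-1 `^ p^-1) * (2^-1 ^+ n) `^ p^-1); last first.
  by rewrite exprS powRM// exprn_ge0.
rewrite mulrA -[leLHS]mul1r; apply: ler_wpM2r; first exact: powR_ge0.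
have : 2^-1 <= 2^-1 `^ p^-1 :> R.
  rewrite -{1}[2^-1](@powRr1 R)//; apply: ger_powR => //.
  by rewrite invr_gt0 ltr0n invf_le1// ler1n.
lra.
Qed.

(** For t in shell k the average at 2^-k is at most the one at t, while the weights differ by at
    most a factor 2 per variable; hence the division by 4. *)
Lemma lq_norm2_net_sample_le : exists2 c : R, 0 < c & forall f : R * R -> R,
  (c%:E * lq_norm2 q1 q2 (net_sample f) <=
   net_norm p1 p2 q1 q2 unit_square_rectangles f)%E.
Proof.
have [c1 c10 h1] := lq_norm_le_Lq q10; have [c2 c20 h2] := lq_norm_le_Lq q20.
exists (c2 * c1 / 4); first by rewrite divr_gt0// mulr_gt0.
move=> f; rewrite /net_norm.
have phi0 t1 t2 : (0 <= (t1 `^ p1^-1 * t2 `^ p2^-1)%R%:E *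
    net_average unit_square_rectangles f t1 t2)%E.
  by rewrite mule_ge0 ?net_average_ge0// lee_fin mulr_ge0 ?powR_ge0.
have N0 k2 : (0 <= lq_norm q1 (fun k1 => net_sample f k1 k2))%E.
  by apply: lq_norm_ge0 => // k1; exact: net_sample_ge0.
apply: (@le_trans _ _ (c2%:E * lq_norm q2 (fun k2 =>
    (c1 / 4)%:E * lq_norm q1 (fun k1 => net_sample f k1 k2)))%E).
  rewrite lq_normZ//; last by rewrite divr_ge0 ?ltW.
  by rewrite muleA -EFinM mulrA.
have Lq0 t2 : (0 <= Lq_dt_over_t_norm q1 (fun t1 => (t1 `^ p1^-1 * t2 `^ p2^-1)%R%:E *
    net_average unit_square_rectangles f t1 t2))%E.
  by apply: Lq_dt_over_t_norm_ge0.
apply: h2 => [k2|t2 _|k2 t2 kt2].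
- by rewrite mule_ge0 ?lee_fin ?divr_ge0// ltW.
- exact: Lq0.
rewrite EFinM -muleA -lq_normZ; [|by []|by rewrite invr_ge0|]; last first.
  by move=> k1; exact: net_sample_ge0.
apply: h1 => // [k1|k1 t1 kt1].
  by rewrite mule_ge0 ?lee_fin ?invr_ge0//; exact: net_sample_ge0.
have /dyadic_shellP/andP[l1 u1] := kt1; have /dyadic_shellP/andP[l2 u2] := kt2.
rewrite /net_sample muleA -EFinM; apply: lee_pmul.
- by rewrite lee_fin !mulr_ge0 ?powR_ge0 ?invr_ge0.
- exact: net_average_ge0.
- rewrite lee_fin.
  have m1 : (2^-1 ^+ k1) `^ p1^-1 <= 2 * t1 `^ p1^-1.
    apply: le_trans (powR_expr_halfS _ p11) _; apply: ler_wpM2l => //.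
    apply: ge0_ler_powR; rewrite ?nnegrE ?invr_ge0 ?exprn_ge0 ?ltW//.
      exact: lt_trans p11.
    by case/andP: (dyadic_shell_gt0 kt1).
  have m2 : (2^-1 ^+ k2) `^ p2^-1 <= 2 * t2 `^ p2^-1.
    apply: le_trans (powR_expr_halfS _ p21) _; apply: ler_wpM2l => //.
    apply: ge0_ler_powR; rewrite ?nnegrE ?invr_ge0 ?exprn_ge0 ?ltW//.
      exact: lt_trans p21.
    by case/andP: (dyadic_shell_gt0 kt2).
  have := ler_pM (powR_ge0 _ _) (powR_ge0 _ _) m1 m2; lra.
- exact: net_average_anti.
Qed.

(** For t in shell k one has t > 2^(-k-1), so the sample at k + 1 is the one that bounds from above;
    omitting the samples of index 0 does not increase the norm. The constant 4 is again a factor 2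
    per variable. *)
Lemma net_norm_le_lq_norm2 (f : R * R -> R) :
  (net_norm p1 p2 q1 q2 unit_square_rectangles f <=
   4%:E * lq_norm2 q1 q2 (net_sample f))%E.
Proof.
have phi0 t1 t2 : (0 <= (t1 `^ p1^-1 * t2 `^ p2^-1)%R%:E *
    net_average unit_square_rectangles f t1 t2)%E.
  by rewrite mule_ge0 ?net_average_ge0// lee_fin mulr_ge0 ?powR_ge0.
have S0 k1 k2 := net_sample_ge0 f k1 k2.
have Lq0 t2 : (0 <= Lq_dt_over_t_norm q1 (fun t1 => (t1 `^ p1^-1 * t2 `^ p2^-1)%R%:E *
    net_average unit_square_rectangles f t1 t2))%E.
  by apply: Lq_dt_over_t_norm_ge0.
apply: (@le_trans _ _ (lq_norm2 q1 q2 (fun k1 k2 => 4%:E * net_sample f k1.+1 k2.+1)%E)); last first.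
  have := @lq_norm2Z R q1 q2 4 (fun k1 k2 => net_sample f k1.+1 k2.+1)
    q10 q20 (ler0n _ 4) (fun _ _ => S0 _ _).
  move=> ->.
  apply: lee_wpmul2l; first by rewrite lee_fin.
  exact: lq_norm2_shift.
apply: Lq_le_lq_norm => // [k2|k2 t2 kt2|t2 t21].
- by apply: lq_norm_ge0 => // k1; rewrite mule_ge0.
- apply: Lq_le_lq_norm => // [k1|k1 t1 kt1|t1 t11]; last 1 first.
  + by rewrite net_average_eq0 ?mule0// t11.
  + by rewrite mule_ge0.
  have /dyadic_shellP/andP[l1 u1] := kt1; have /dyadic_shellP/andP[l2 u2] := kt2.
  rewrite /net_sample muleA -EFinM; apply: lee_pmul.
  + by rewrite lee_fin !mulr_ge0 ?powR_ge0.
  + exact: net_average_ge0.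
  + rewrite lee_fin.
    have m1 : t1 `^ p1^-1 <= 2 * (2^-1 ^+ k1.+1) `^ p1^-1.
      apply: le_trans (powR_expr_halfS _ p11).
      have /andP[t0 _] := dyadic_shell_gt0 kt1.
      have pp : 0 <= p1^-1 by rewrite invr_ge0 ltW// (lt_trans ltr01).
      by apply: ge0_ler_powR; rewrite ?nnegrE ?exprn_ge0 ?(ltW t0).
    have m2 : t2 `^ p2^-1 <= 2 * (2^-1 ^+ k2.+1) `^ p2^-1.
      apply: le_trans (powR_expr_halfS _ p21).
      have /andP[t0 _] := dyadic_shell_gt0 kt2.
      have pp : 0 <= p2^-1 by rewrite invr_ge0 ltW// (lt_trans ltr01).
      by apply: ge0_ler_powR; rewrite ?nnegrE ?exprn_ge0 ?(ltW t0).
    have := ler_pM (powR_ge0 _ _) (powR_ge0 _ _) m1 m2; lra.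
  + by apply: net_average_anti; exact: ltW.
(* For t2 > 1 the inner norm vanishes, by comparison with the zero sequence, whose norm is 0 by
   homogeneity. *)
- apply/le_anti; rewrite Lq0 andbT.
  apply: le_trans (Lq_le_lq_norm (b := fun=> 0%E) _ _ _ _ _) _ => //.
  + by move=> k t _; rewrite net_average_eq0 ?mule0// t21 orbT.
  + by move=> t t1; rewrite net_average_eq0 ?mule0// t1.
  + have -> : (fun=> 0%E) = (fun k : nat => 0%:E * (fun=> 0%E) k)%E :> (nat -> \bar R).
      by apply/funext => k; rewrite mule0.
    by rewrite lq_normZ// mul0e.
Qed.

End discretization.

(** * Comparison of the two norms *)

Section haar_side.
Context {R : realType}.
Implicit Types f : R * R -> R.

Definition haar_coef_sup f (k1 k2 : nat) : \bar R :=
  ereal_sup [set `|haar_coef f k1 k2 j.1 j.2|%:E |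
             j in haar_level_full k1 `*` haar_level_full k2].

Lemma haar_level_full1 k : haar_level_full k 1.
Proof. by left; rewrite /haar_level/= expn_gt0. Qed.

Lemma haar_level_full_lt k j : haar_level_full k j -> (j < (2 ^ k).+1)%N.
Proof. by case => [/andP[_]|[-> ->]]. Qed.

Lemma haar_coef_sup_ge0 f k1 k2 : (0 <= haar_coef_sup f k1 k2)%E.
Proof.
apply: le_ereal_sup_tmp; exists `|haar_coef f k1 k2 1 1|%:E; last by rewrite lee_fin.
by exists (1%N, 1%N) => //; split; exact: haar_level_full1.
Qed.

Lemma haar_coef_sup_fin_num f k1 k2 : haar_coef_sup f k1 k2 \is a fin_num.
Proof.
rewrite ge0_fin_numE ?haar_coef_sup_ge0//.
apply: (@le_lt_trans _ _ (\sum_(j1 < (2 ^ k1).+1) \sum_(j2 < (2 ^ k2).+1)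
   `|haar_coef f k1 k2 j1 j2|)%:E); last by rewrite ltry.
apply/ereal_supP => _ [[j1 j2] [/=/haar_level_full_lt l1 /haar_level_full_lt l2] <-].
rewrite lee_fin (bigD1 (Ordinal l1))//= (bigD1 (Ordinal l2))//= -addrA lerDl.
by rewrite addr_ge0// sumr_ge0// => i _; rewrite sumr_ge0.
Qed.

Definition haar_sample (p1 p2 : R) f (k1 k2 : nat) : \bar R :=
  ((2 `^ ((1 / 2 - 1 / p1) * k1%:R + (1 / 2 - 1 / p2) * k2%:R))%:E *
   haar_coef_sup f k1 k2)%E.

Lemma haar_sample_ge0 p1 p2 f k1 k2 : (0 <= haar_sample p1 p2 f k1 k2)%E.
Proof. by rewrite mule_ge0 ?haar_coef_sup_ge0// lee_fin powR_ge0. Qed.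

(** The exponent 1/2 - 1/p splits into the weight 2^(-k/p) of the net samples and the height 2^(k/2)
    of the Haar functions, which is why this sigma matches the two norms. *)
Lemma haar_weightE (p1 p2 : R) (k1 k2 : nat) :
  2 `^ ((1 / 2 - 1 / p1) * k1%:R + (1 / 2 - 1 / p2) * k2%:R) =
  ((2^-1 ^+ k1) `^ p1^-1 * (2^-1 ^+ k2) `^ p2^-1) *
  (2 `^ (k1%:R / 2) * 2 `^ (k2%:R / 2)) :> R.
Proof.
have E (p : R) (k : nat) : 2 `^ ((1 / 2 - 1 / p) * k%:R) =
    (2^-1 ^+ k) `^ p^-1 * 2 `^ (k%:R / 2) :> R.
  rewrite -powR_mulrn ?invr_ge0// -powR_inv1// -!powRrM -powR2D.
  by congr (_ `^ _); rewrite !div1r; lra.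
by rewrite powR2D !E mulrACA.
Qed.

(** Coefficients of level k see averages at scale 2^(-k-1); moving the weight from 2^-k to that
    scale costs a factor 2 per variable. *)
Lemma haar_sample_le_net_sample (p1 p2 : R) f k1 k2 : 1 < p1 -> 1 < p2 ->
  L1_unit_square f ->
  (haar_sample p1 p2 f k1 k2 <= 4%:E * net_sample p1 p2 f k1.+1 k2.+1)%E.
Proof.
move=> p11 p21 hf; rewrite /haar_sample haar_weightE EFinM -muleA.
set F := net_average unit_square_rectangles f (2^-1 ^+ k1.+1) (2^-1 ^+ k2.+1).
have s0 : 0 <= 2 `^ (k1%:R / 2) * 2 `^ (k2%:R / 2) :> R.
  by rewrite mulr_ge0// powR_ge0.
apply: (@le_trans _ _ (((2^-1 ^+ k1) `^ p1^-1 * (2^-1 ^+ k2) `^ p2^-1)%:E * F)%E).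
  apply: lee_wpmul2l; first by rewrite lee_fin mulr_ge0// powR_ge0.
  rewrite muleC -lee_pdivlMr; last by rewrite mulr_gt0// powR_gt0.
  apply/ereal_supP => _ [[j1 j2] [/= l1 l2] <-].
  rewrite lee_pdivlMr; last by rewrite mulr_gt0// powR_gt0.
  by rewrite muleC -EFinM; exact: haar_coef_le_net_average.
rewrite /net_sample muleA -EFinM; apply: lee_wpmul2r; first exact: net_average_ge0.
rewrite lee_fin.
have := ler_pM (powR_ge0 _ _) (powR_ge0 _ _)
  (powR_expr_halfS k1 p11) (powR_expr_halfS k2 p21).
lra.
Qed.

(* At n <= k the interval Q averages out the oscillation of haar k j (this
   needs p > 1); at k <= n the weight itself decays. *)
Lemma weight_decay (p rho : R) (k n : nat) :
  0 <= rho -> 2^-1 `^ p^-1 <= rho -> 2^-1 <= rho * 2^-1 `^ p^-1 ->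
  (2^-1 ^+ n) `^ p^-1 * 2^-1 ^+ (k - n) <= rho ^+ dist k n * (2^-1 ^+ k) `^ p^-1.
Proof.
move=> rho0 h1 h2; rewrite !powR_exprn//.
set tau := 2^-1 `^ p^-1 in h1 h2 *; have tau0 : 0 <= tau by exact: powR_ge0.
have [kn|nk] := leqP k n.
  have -> : dist k n = (n - k)%N by rewrite /dist; lia.
  have -> : (k - n)%N = 0%N by lia.
  rewrite expr0 mulr1 -{1}(subnK kn) exprD; apply: ler_wpM2r; first exact: exprn_ge0.
  by apply: lerXn2r; rewrite ?nnegrE.
have -> : dist k n = (k - n)%N by rewrite /dist; lia.
rewrite -{3}(subnK (ltnW nk)) exprD mulrA -exprMn mulrC.
apply: ler_wpM2r; first exact: exprn_ge0.
by apply: lerXn2r; rewrite ?nnegrE ?mulr_ge0.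
Qed.

(** The decay rates are 2^(-1/p) for k < n and 2^(1/p - 1) for k > n, both below 1 as p > 1. [eta]
    is the cube root of the largest of the four. *)
Lemma decay_rate_exists (p1 p2 : R) : 1 < p1 -> 1 < p2 -> exists2 eta : R, 0 < eta < 1 &
  [/\ 2^-1 `^ p1^-1 <= eta ^+ 3, 2^-1 <= eta ^+ 3 * 2^-1 `^ p1^-1,
      2^-1 `^ p2^-1 <= eta ^+ 3 & 2^-1 <= eta ^+ 3 * 2^-1 `^ p2^-1].
Proof.
move=> p11 p21.
have lt1 (x : R) : 0 < x -> 2^-1 `^ x < 1.
  move=> x0; rewrite -[ltRHS](congr1 (@^~ x) (powR1 R)) gt0_ltr_powR// ?nnegrE//.
  by rewrite invf_lt1// ltr1n.
have tau (p : R) : 1 < p -> 0 < 2^-1 `^ p^-1 < 1 /\ 2^-1 / 2^-1 `^ p^-1 < 1.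
  move=> hp; have pV0 : 0 < p^-1 by rewrite invr_gt0; lra.
  have pV1 : p^-1 < 1 by rewrite invf_lt1; lra.
  rewrite powR_gt0//= lt1//; split => //.
  rewrite ltr_pdivrMr ?powR_gt0// mul1r.
  have E : 2^-1 = 2^-1 `^ p^-1 * 2^-1 `^ (1 - p^-1) :> R.
    by rewrite -powRD ?invr_eq0 ?pnatr_eq0 ?implybT// addrC subrK powRr1.
  by rewrite [ltLHS]E gtr_pMr ?powR_gt0// lt1// subr_gt0.
have [/andP[a0 a1] a2] := tau _ p11; have [/andP[b0 b1] b2] := tau _ p21.
pose rho := Num.max (Num.max (2^-1 `^ p1^-1) (2^-1 / 2^-1 `^ p1^-1))
                    (Num.max (2^-1 `^ p2^-1) (2^-1 / 2^-1 `^ p2^-1)) : R.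
have rho0 : 0 < rho by rewrite /rho !lt_max a0.
have rho1 : rho < 1 by rewrite /rho !gt_max a1 a2 b1 b2.
exists (rho `^ 3^-1).
  rewrite powR_gt0//= -[ltRHS](congr1 (@^~ 3^-1) (powR1 R)).
  by rewrite gt0_ltr_powR ?nnegrE ?ltW.
have -> : rho `^ 3^-1 ^+ 3 = rho.
  by rewrite -powR_mulrn ?powR_ge0// -powRrM mulVf// powRr1// ltW.
split.
- by rewrite /rho !le_max lexx.
- by rewrite -ler_pdivrMr// /rho !le_max lexx orbT.
- by rewrite /rho !le_max lexx !orbT.
- by rewrite -ler_pdivrMr// /rho !le_max lexx !orbT.
Qed.

(** Of the three powers of [eta] from [weight_decay], one is summed over the levels, which gives a
    factor [G] per variable, and the others are absorbed by the supremum. The factor 9 is that of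
    the rectangle estimate. *)
Lemma net_sample_le_haar_sample (p1 p2 eta : R) : 1 < p1 -> 1 < p2 -> 0 < eta < 1 ->
  2^-1 `^ p1^-1 <= eta ^+ 3 -> 2^-1 <= eta ^+ 3 * 2^-1 `^ p1^-1 ->
  2^-1 `^ p2^-1 <= eta ^+ 3 -> 2^-1 <= eta ^+ 3 * 2^-1 `^ p2^-1 ->
  exists2 C : R, 0 < C & forall f n1 n2, L1_unit_square f ->
  (net_sample p1 p2 f n1 n2 <= C%:E * ereal_sup (range (fun k2 =>
     (eta ^+ dist k2 n2)%:E * ((eta ^+ dist k2 n2)%:E * ereal_sup (range (fun k1 =>
       (eta ^+ dist k1 n1)%:E * haar_sample p1 p2 f k1 k2))))))%E.
Proof.
move=> p11 p21 eta01 h11 h12 h21 h22; have /andP[eta0 eta1] := eta01.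
pose G := 2 / (1 - eta); have G0 : 0 < G by rewrite divr_gt0// subr_gt0.
have GG0 : 0 < 9 * (G * G) by apply: mulr_gt0; [rewrite ltr0n|exact: mulr_gt0].
exists (9 * (G * G)) => //.
move=> f n1 n2 hf; set S := ereal_sup _.
have w0 m n : 0 <= eta ^+ dist m n by rewrite exprn_ge0// ltW.
pose A k1 k2 := fine (haar_coef_sup f k1 k2).
have AE k1 k2 : haar_coef_sup f k1 k2 = (A k1 k2)%:E.
  by rewrite fineK// haar_coef_sup_fin_num.
have A0 k1 k2 : 0 <= A k1 k2 by rewrite -lee_fin -AE haar_coef_sup_ge0.
pose alpha k1 k2 : R := ((2^-1 ^+ k1) `^ p1^-1 * (2^-1 ^+ k2) `^ p2^-1) *
  (2 `^ (k1%:R / 2) * 2 `^ (k2%:R / 2)) * A k1 k2.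
have alphaE k1 k2 : haar_sample p1 p2 f k1 k2 = (alpha k1 k2)%:E.
  by rewrite /haar_sample haar_weightE AE -EFinM.
have alpha0 k1 k2 : 0 <= alpha k1 k2.
  by rewrite -lee_fin -alphaE haar_sample_ge0.
(* The supremum carries the k1 weight only once; squaring it makes it smaller, as [eta < 1], and
   keeps the two variables symmetric below. *)
have wS k1 k2 : (((eta ^+ dist k1 n1) ^+ 2 * (eta ^+ dist k2 n2) ^+ 2 *
    alpha k1 k2)%:E <= S)%E.
  apply: le_ereal_sup_tmp; eexists; first by exists k2.
  rewrite muleA -EFinM.
  apply: (@le_trans _ _ ((eta ^+ dist k2 n2 * eta ^+ dist k2 n2)%:E *
      ((eta ^+ dist k1 n1)%:E * haar_sample p1 p2 f k1 k2))%E).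
    rewrite alphaE -!EFinM lee_fin.
    have y1 : eta ^+ dist k1 n1 <= 1 by rewrite exprn_ile1// ltW.
    have := ler_wpM2l (mulr_ge0 (mulr_ge0 (w0 k2 n2) (w0 k2 n2))
      (mulr_ge0 (w0 k1 n1) (alpha0 k1 k2))) y1.
    by move: (eta ^+ _) (eta ^+ _) (alpha _ _) => y2 y3 z; lra.
  apply: lee_wpmul2l; first by rewrite lee_fin mulr_ge0.
  by apply: ereal_sup_ubound; exists k1.
have S0 : (0 <= S)%E.
  by apply: le_trans (wS 0 0)%N; rewrite lee_fin !mulr_ge0// exprn_ge0.
have [->|Sy] := eqVneq S +oo%E.
  by rewrite gt0_muley ?leey// lte_fin.
have SE : S = (fine S)%:E by rewrite fineK// ge0_fin_numE// ltey.
move: wS S0; rewrite {}SE; move: (fine S) => s wS; rewrite lee_fin => s0.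
pose W : R := (2^-1 ^+ n1) `^ p1^-1 * (2^-1 ^+ n2) `^ p2^-1.
have W0 : 0 < W by rewrite mulr_gt0// powR_gt0// expr_half_gt0.
have hE (N : nat) : \sum_(k1 < N) \sum_(k2 < N)
     (2 `^ (k1%:R / 2) * 2^-1 ^+ (k1 - n1)) *
     (2 `^ (k2%:R / 2) * 2^-1 ^+ (k2 - n2)) * A k1 k2 <= G * G * s / W.
  rewrite ler_pdivlMr// mulr_suml.
  apply: (@le_trans _ _ (\sum_(k1 < N) \sum_(k2 < N)
      (eta ^+ dist k1 n1 * (eta ^+ dist k2 n2 * s)))).
    apply: ler_sum => k1 _; rewrite mulr_suml; apply: ler_sum => k2 _.
    have d1 := weight_decay k1 n1 (exprn_ge0 3 (ltW eta0)) h11 h12.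
    have d2 := weight_decay k2 n2 (exprn_ge0 3 (ltW eta0)) h21 h22.
    have := ler_pM _ _ d1 d2.
    rewrite !mulr_ge0 ?powR_ge0 ?exprn_ge0// => /(_ isT isT) d12.
    have t0 : 0 <= 2 `^ (k1%:R / 2) * 2 `^ (k2%:R / 2) * A k1 k2.
      by rewrite !mulr_ge0 ?powR_ge0.
    have := ler_wpM2l t0 d12.
    have := ler_wpM2l (mulr_ge0 (w0 k1 n1) (w0 k2 n2)) (wS k1 k2).
    rewrite /alpha /W -!exprM ![(3 * _)%N]mulnC !exprM.
    set x1 := eta ^+ dist k1 n1; set x2 := eta ^+ dist k2 n2.
    move: (x1) (x2) => y1 y2.
    set u1 := (2^-1 ^+ k1) `^ _; set u2 := (2^-1 ^+ k2) `^ _.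
    set v1 := (2^-1 ^+ n1) `^ _; set v2 := (2^-1 ^+ n2) `^ _.
    set z1 := 2^-1 ^+ (k1 - n1); set z2 := 2^-1 ^+ (k2 - n2).
    lra.
  have -> : \sum_(k1 < N) \sum_(k2 < N) (eta ^+ dist k1 n1 * (eta ^+ dist k2 n2 * s)) =
      (\sum_(k1 < N) eta ^+ dist k1 n1) * (\sum_(k2 < N) eta ^+ dist k2 n2) * s.
    rewrite mulr_suml mulr_suml; apply: eq_bigr => k1 _.
    by rewrite -mulrA mulr_suml mulr_sumr.
  apply: ler_wpM2r => //.
  have := sum_expr_dist n1 N eta01; have := sum_expr_dist n2 N eta01.
  rewrite !big_mkord => g2 g1.
  by apply: ler_pM => //; apply: sumr_ge0.
have hA k1 k2 j1 j2 : haar_level_full k1 j1 -> haar_level_full k2 j2 ->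
    `|haar_coef f k1 k2 j1 j2| <= A k1 k2.
  move=> l1 l2; rewrite -lee_fin -AE; apply: ereal_sup_ubound.
  by exists (j1, j2).
rewrite /net_sample -/W.
rewrite muleC -lee_pdivlMr// -EFinM.
apply/ereal_supP => _ [->|[[Q1 Q2] [[/= [a1 [b1 [ab1 E1]]] [a2 [b2 [ab2 E2]]] s1 s2] t1 t2] <-]].
  by rewrite lee_fin divr_ge0 ?(ltW W0)// mulr_ge0// ltW.
rewrite /= in t1 t2 *; subst Q1 Q2; rewrite len_segment// in t1.
rewrite len_segment// in t2; rewrite !len_segment//.
have in01 (a b : R) : a < b -> `[a, b]%classic `<=` `[0, 1]%classic -> 0 <= a /\ b <= 1.
  move=> ab ab01.
  have := ab01 a; rewrite /= !in_itv/= lexx (ltW ab) => /(_ isT)/andP[a0 _].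
  by have := ab01 b; rewrite /= !in_itv/= lexx (ltW ab) => /(_ isT)/andP[_ ?].
have [a10 b11] := in01 _ _ ab1 s1; have [a20 b21] := in01 _ _ ab2 s2.
rewrite lee_fin ler_pdivrMl ?mulr_gt0 ?subr_gt0//.
apply: le_trans (integral_rectangle_le hf hA hE a10 ab1 b11 t1 a20 ab2 b21 t2) _.
by rewrite !mulrA.
Qed.

Lemma lq_norm2_net_sample_haar_sample (p1 p2 : R) (q1 q2 : \bar R) :
  1 < p1 -> 1 < p2 -> (0 < q1)%E -> (0 < q2)%E ->
  exists2 C : R, 0 < C & forall f, L1_unit_square f ->
  (lq_norm2 q1 q2 (net_sample p1 p2 f) <=
   C%:E * lq_norm2 q1 q2 (haar_sample p1 p2 f))%E.
Proof.
move=> p11 p21 q10 q20.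
have [eta eta01 [h11 h12 h21 h22]] := decay_rate_exists p11 p21.
have [C1 C10 h1] := net_sample_le_haar_sample p11 p21 eta01 h11 h12 h21 h22.
have [C2 C20 h2] := @lq_norm2_convolution_sup R q1 q2 eta q10 q20 eta01.
exists (C1 * C2); first by rewrite mulr_gt0.
move=> f hf.
apply: le_trans (le_lq_norm2 q10 q20 (net_sample_ge0 p1 p2 f)
  (fun n1 n2 => h1 f n1 n2 hf)) _.
rewrite lq_norm2Z ?(ltW C10)//; last first.
  move=> n1 n2; apply: le_ereal_sup_tmp; eexists; first by exists 0.
  have e0 m n : (0 <= (eta ^+ dist m n)%:E)%E.
    by rewrite lee_fin exprn_ge0// ltW//; case/andP: eta01.
  rewrite !mule_ge0//; apply: le_ereal_sup_tmp; eexists; first by exists 0.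
  by rewrite mule_ge0// haar_sample_ge0.
rewrite EFinM -muleA; apply: lee_wpmul2l; first by rewrite lee_fin ltW.
by apply: h2 => k1 k2; exact: haar_sample_ge0.
Qed.

(** The additional indices contribute only zeros, which do not raise a supremum of absolute values
    over a nonempty level. *)
Lemma seq_norm_no_constant_terms f s1 s2 q1 q2 : no_constant_terms f ->
  seq_norm haar_level s1 s2 q1 q2 (haar_coef f) =
  seq_norm haar_level_full s1 s2 q1 q2 (haar_coef f).
Proof.
move=> nf; rewrite /seq_norm; congr lq_norm; apply/funext => k2.
congr lq_norm; apply/funext => k1; congr (_ * _)%E.
apply/le_anti/andP; split.
  by apply: ereal_sup_le => _ [[j1 j2] [/= l1 l2] <-]; exists (j1, j2) => //; split; left.
apply/ereal_supP => _ [[j1 j2] [/= l1 l2] <-].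
have z : haar_coef f k1 k2 j1 j2 = 0 -> (`|haar_coef f k1 k2 j1 j2|%:E <=
    ereal_sup [set `|haar_coef f k1 k2 j.1 j.2|%:E | j in haar_level k1 `*` haar_level k2])%E.
  move=> ->; rewrite normr0; apply: le_ereal_sup_tmp.
  exists `|haar_coef f k1 k2 1 1|%:E; last by rewrite lee_fin.
  by exists (1%N, 1%N) => //; split; rewrite /haar_level/= expn_gt0.
case: (l1) => [h1|[k10 j10]]; last first.
  by apply: z; rewrite k10 j10; have [] := nf _ _ l2.
case: (l2) => [h2|[k20 j20]]; last first.
  by apply: z; rewrite k20 j20; have [] := nf _ _ l1.
by apply: ereal_sup_ubound; exists (j1, j2).
Qed.

End haar_side.

Unset Implicit Arguments.

(** For f = 1 every coefficient with 1 <= j_i <= 2^k_i vanishes while the net norm is positive. The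
    equivalence is therefore stated with the constant Haar function in level 0, and with the smaller
    levels for functions having no constant terms. *)
Theorem theorem1 (R : realType) (p1 p2 : R) (q1 q2 : \bar R)
    (hp1 : 1 < p1) (hp2 : 1 < p2) (hq1 : (0 < q1)%E) (hq2 : (0 < q2)%E) :
  let s1 : R := 1 / 2 - 1 / p1 in
  let s2 : R := 1 / 2 - 1 / p2 in
  let M : set (set R * set R) := unit_square_rectangles in
  exists c1 c2 : R, [/\ 0 < c1, 0 < c2 &
    forall f : R * R -> R, L1_unit_square f ->
      (* complete Haar system, constant function in level 0 *)
      [/\ net_space p1 p2 q1 q2 M f <->
            seq_space haar_level_full s1 s2 q1 q2 (haar_coef f),
          (c1%:E * seq_norm haar_level_full s1 s2 q1 q2 (haar_coef f)
             <= net_norm p1 p2 q1 q2 M f)%E &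
          (net_norm p1 p2 q1 q2 M f
             <= c2%:E * seq_norm haar_level_full s1 s2 q1 q2 (haar_coef f))%E]
      /\
      (* coefficients with 1 <= j_i <= 2 ^ k_i only *)
      (no_constant_terms f ->
       [/\ net_space p1 p2 q1 q2 M f <->
             seq_space haar_level s1 s2 q1 q2 (haar_coef f),
           (c1%:E * seq_norm haar_level s1 s2 q1 q2 (haar_coef f)
              <= net_norm p1 p2 q1 q2 M f)%E &
           (net_norm p1 p2 q1 q2 M f
              <= c2%:E * seq_norm haar_level s1 s2 q1 q2 (haar_coef f))%E])].
Proof.
move=> s1 s2 M.
have [c c0 hc] := lq_norm2_net_sample_le hp1 hp2 hq1 hq2.
have [C C0 hC] := lq_norm2_net_sample_haar_sample hp1 hp2 hq1 hq2.
exists (c / 4), (4 * C); split; [exact: divr_gt0|exact: mulr_gt0|].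
move=> f hf; set S := seq_norm haar_level_full _ _ _ _ _.
have SE : S = lq_norm2 q1 q2 (haar_sample p1 p2 f) by [].
have lower : ((c / 4)%:E * S <= net_norm p1 p2 q1 q2 M f)%E.
  apply: le_trans (hc f); rewrite EFinM -muleA.
  apply: lee_wpmul2l; first by rewrite lee_fin ltW.
  rewrite lee_pdivrMl//.
  apply: (@le_trans _ _ (lq_norm2 q1 q2
      (fun k1 k2 => 4%:E * net_sample p1 p2 f k1.+1 k2.+1)%E)).
    apply: le_lq_norm2 => // k1 k2; first exact: haar_sample_ge0.
    exact: haar_sample_le_net_sample.
  have := @lq_norm2Z R q1 q2 4 (fun k1 k2 => net_sample p1 p2 f k1.+1 k2.+1)
    hq1 hq2 (ler0n _ 4) (fun _ _ => net_sample_ge0 _ _ _ _ _).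
  move=> ->; apply: lee_wpmul2l; first by rewrite lee_fin.
  by apply: lq_norm2_shift => // *; exact: net_sample_ge0.
have upper : (net_norm p1 p2 q1 q2 M f <= (4 * C)%:E * S)%E.
  apply: le_trans (net_norm_le_lq_norm2 hp1 hp2 hq1 hq2 f) _.
  rewrite EFinM -muleA; apply: lee_wpmul2l; first by rewrite lee_fin.
  exact: hC.
have S0 : (0 <= S)%E by apply: lq_norm2_ge0 => // *; exact: haar_sample_ge0.
(* Integrability over the square gives it over every rectangle, so membership reduces to finiteness
   of the norm. *)
have iff : net_space p1 p2 q1 q2 M f <-> (S < +oo)%E.
  split => [[_ fin]|fin].
    have := le_lt_trans lower fin.
    have [->|] := eqVneq S +oo%E; last by move=> Sy _; rewrite ltey.
    by rewrite gt0_muley// lte_fin divr_gt0.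
  split; last first.
    apply: le_lt_trans upper _; apply: lte_mul_pinfty => //.
    by rewrite lee_fin mulr_ge0// ltW.
  move=> Q [[a1 [b1 [_ Q1]]] [a2 [b2 [_ Q2]]] h1 h2].
  apply: (integrableS _ _ _ hf); first exact: measurable_sq.
    by rewrite Q1 Q2; apply: measurableX; exact: measurable_itv.
  by move=> x [/h1 ? /h2 ?].
split; first by [].
by move=> nf; rewrite /seq_space/= seq_norm_no_constant_terms.
Qed.
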